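(* For $z=x+\mathrm{i}y\in\mathbb{C}$, the infinite matrix $L(z)=(L_{kj}(z))_{k,j\ge 0}$ satisfies $$C\,L(z)-\mathrm{i}\,L(z)\,C^\top=F(z),$$ where $F(z):=F^{(2)}(z)-F^{(1)}(z)$ has at most rank $3$, and $$C:=A-B=\begin{pmatrix}0&1\\-1/3&0&1/3\\&-1/5&0&1/5\\&&-1/7&0&\ddots\\&&&\ddots&\ddots\end{pmatrix},$$ that is (rows and columns indexed from $0$) $C_{k,k+1}=\frac{1}{2k+1}$ for $k\ge 0$, $C_{k,k-1}=-\frac{1}{2k+1}$ for $k\ge 1$, and all other entries vanish.
   Context: Conventions: $\log$ is the principal complex logarithm with $\arg\in(-\pi,\pi]$; expressions $w\log w$ are read as $0$ at $w=0$. Write $z=x+\mathrm{i}y$. $P_k$ is the $k$-th Legendre polynomial. $\Omega=\{(x,y):-1\le x,y\le 1\}$, identified with a subset of $\mathbb{C}$ via $(x,y)\mapsto x+\mathrm{i}y$. Infinite matrices are indexed from $0$; products with tridiagonal matrices are entrywise finite sums. $A$ and $B$ are the infinite tridiagonal matrices with $A_{k,k-1}=\frac{k-1}{2k+1}$, $B_{k,k-1}=\frac{k}{2k+1}$ for $k\ge1$, $A_{k,k+1}=\frac{k+2}{2k+1}$, $B_{k,k+1}=\frac{k+1}{2k+1}$ for $k\ge0$, and all other entries $0$. $L_{kj}(z)=\iint_\Omega \log(z-(s+\mathrm{i}t))P_k(s)P_j(t)\,ds\,dt$ for $k,j\ge0$; $L(z)$ has $(k,j)$ entry $L_{kj}(z)$.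 One-dimensional integrals: $L_k(z)=\int_{-1}^1\log(z-t)P_k(t)\,dt$ and $M_k(z)=\int_{-1}^1\log(z-\mathrm{i}t)P_k(t)\,dt$ for $k\ge 0$, with $L_{-1}=M_{-1}=0$. Ultraspherical polynomials: $C_0^{(-1/2)}(x)=1$, $C_1^{(-1/2)}(x)=-x$, $C_n^{(-1/2)}(x)=\frac{(1-x^2)C_{n-2}^{(3/2)}(x)}{n(n-1)}$ for $n\ge2$, with $C_m^{(3/2)}$ the standard Gegenbauer polynomials; $C_n^{(-3/2)}(x)$ is the coefficient of $r^n$ in the power series of $(1-2xr+r^2)^{3/2}$. $\lambda_0(z)=(z-1)\log(z-1)+(z+1)\log(z+1)$, $\lambda_1(z)=-2/3$, $\lambda_k(z)=0$ for $k\ge2$. $\log_-z=\log|z|-\mathrm{i}\pi$ if $y=0$ and $x<0$, and $\log_-z=\log z$ otherwise. $\mu_k(z)=m_k(z)-n_k(z)$ where $m_0(z)=(z-\mathrm{i})\log(z-\mathrm{i})+(z+\mathrm{i})\log_-(z+\mathrm{i})$, $m_1(z)=-2\mathrm{i}/3$, $m_k(z)=0$ for $k\ge2$, and $n_k(z)=2\mathrm{i}\pi x\,C_{k+1}^{(-1/2)}(y)$ if $x<0$ and $-1<y<1$, $n_k(z)=0$ otherwise. $\beta_{kj}(z)=2\mathrm{i}\pi C_{j+1}^{(-1/2)}(y)\,b_k(z)$ where $b_k(z)=\frac{C_{k+2}^{(-3/2)}(x)}{3}-\delta_{k0}x+\frac{\delta_{k1}}{3}$ if $z\in\Omega$; $b_k(z)=-2x\delta_{k0}+\frac{2\delta_{k1}}{3}$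 if $x<-1$ and $-1<y<1$; $b_k(z)=0$ otherwise. The matrices $F^{(1)}(z),F^{(2)}(z)$ have $(k,j)$ entries: $F_{0j}^{(1)}(z)=\mathrm{i}\frac{M_{j+1}(z-1)+M_{j+1}(z+1)-M_{j-1}(z-1)-M_{j-1}(z+1)}{2j+1}+\mu_j(z-1)+\mu_j(z+1)$; $F_{10}^{(1)}(z)=-4/3$; $F_{kj}^{(1)}(z)=0$ for $k\ne0$, $(k,j)\neq(1,0)$; $F_{k0}^{(2)}(z)=\frac{L_{k+1}(z-\mathrm{i})+L_{k+1}(z+\mathrm{i})-L_{k-1}(z-\mathrm{i})-L_{k-1}(z+\mathrm{i})}{2k+1}+\lambda_k(z-\mathrm{i})+\lambda_k(z+\mathrm{i})+\beta_{k0}(z)$; $F_{01}^{(2)}(z)=-4\mathrm{i}/3+\beta_{01}(z)$; $F_{kj}^{(2)}(z)=\beta_{kj}(z)$ for $j\ne0$, $(k,j)\ne(0,1)$.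
   Formalization: The matrix equation is proved except where y=1, -1≤x<1 or y=-1, x<-1; there it fails (at z=i the (0,0) entries differ by iπ). It is proved for every z once both cases of b_k are taken on -1≤y<1. The rank bound is proved for every z. *)

(* Defs.v *)
From HB Require Import structures.
From mathcomp Require Import all_boot all_order all_algebra.
From mathcomp Require Import all_classical all_reals all_analysis.
From mathcomp Require Import complex.

Set Implicit Arguments.
Unset Strict Implicit.
Unset Printing Implicit Defensive.

Import Order.TTheory GRing.Theory Num.Theory.
Import numFieldNormedType.Exports.

Local Open Scope classical_set_scope.
Local Open Scope ring_scope.
Local Open Scope complex_scope.

Local Notation Re := complex.Re.
Local Notation Im := complex.Im.

Section Logarithms.
Context {R : realType}.
Implicit Type z : R[i].

(* Argument in ]-pi, pi]; the value at 0 (pi / 2) is irrelevant below. *)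
Definition carg z : R :=
  let a := acos (Re z / Normc.normc z) in if 0 <= Im z then a else - a.

(* The value at 0 is junk: it only occurs multiplied by 0, or on a null set
   inside an integral. *)
Definition clog z : R[i] := ln (Normc.normc z) +i* carg z.

Definition clog_ z : R[i] :=
  if (Im z == 0) && (Re z < 0) then ln (Normc.normc z) -i* pi else clog z.

End Logarithms.

Section Integrals.
Context {R : realType}.

Definition cintegral d (T : measurableType d)
    (mu : {measure set T -> \bar R}) (D : set T) (f : T -> R[i]) : R[i] :=
  Rintegral mu D (fun x => Re (f x)) +i* Rintegral mu D (fun x => Im (f x)).

(* Rodrigues' formula. *)
Definition legendre (k : nat) : {poly R} :=
  (2 ^+ k * k`!%:R)^-1 *: (('X^2 - 1) ^+ k)^`(k).

Definition square : set (R * R) := `[-1, 1] `*` `[-1, 1].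

Definition L2 (z : R[i]) (k j : nat) : R[i] :=
  cintegral (@lebesgue_measure R \x @lebesgue_measure R)%E square
    (fun p => clog (z - (p.1 +i* p.2)) *
              ((legendre k).[p.1] * (legendre j).[p.2])%:C).

Definition L1 (k : nat) (z : R[i]) : R[i] :=
  cintegral (@lebesgue_measure R) `[-1, 1]
    (fun t => clog (z - t%:C) * ((legendre k).[t])%:C).

Definition M1 (k : nat) (z : R[i]) : R[i] :=
  cintegral (@lebesgue_measure R) `[-1, 1]
    (fun t => clog (z - 'i%C * t%:C) * ((legendre k).[t])%:C).

(* f (k - 1), with the convention f (-1) = 0. *)
Definition pred_entry (f : nat -> R[i]) (k : nat) : R[i] :=
  if k is k'.+1 then f k' else 0.

End Integrals.

Section Ultraspherical.
Context {R : realType}.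
Implicit Types (n : nat) (x : R).

(* The coefficient of r^n in the power series of (1 - 2xr + r^2)^(-lam), as the
   n-th Taylor coefficient at r = 0. *)
Definition gegenbauer (lam : R) n x : R :=
  derive1n n (fun r : R => (1 - 2 * x * r + r ^+ 2) `^ (- lam)) 0 / n`!%:R.

Definition ultra_m12 n x : R :=
  match n with
  | 0 => 1
  | 1 => - x
  | n'.+2 =>
      (1 - x ^+ 2) * gegenbauer (3 / 2) n' x / (n%:R * (n.-1)%:R)
  end.

Definition ultra_m32 n x : R := gegenbauer (- (3 / 2)) n x.

End Ultraspherical.

Section InfiniteMatrices.

Definition infmx (K : Type) := nat -> nat -> K.

Definition infmx_tr (K : Type) (A : infmx K) : infmx K := fun k j => A j k.

(* The sum ranges over the support of the summand, which is finite as soon as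
   one of the factors is tridiagonal. *)
Definition infmx_mul (K : pzRingType) (A B : infmx K) : infmx K :=
  fun k j => \sum_(l \in [set: nat]) (A k l * B l j).

(* All columns lie in the span of r sequences, i.e. the column space has
   dimension at most r. *)
Definition infmx_rank_le (K : pzRingType) (r : nat) (A : infmx K) : Prop :=
  exists u : 'I_r -> nat -> K, forall j, exists a : 'I_r -> K,
    forall k, A k j = \sum_(i < r) a i * u i k.

Context (K : fieldType).

Definition mxA : infmx K := fun k j =>
  if k == j.+1 then (k%:R - 1) / (2 * k%:R + 1)
  else if j == k.+1 then (k%:R + 2) / (2 * k%:R + 1)
  else 0.

Definition mxB : infmx K := fun k j =>
  if k == j.+1 then k%:R / (2 * k%:R + 1)
  else if j == k.+1 then (k%:R + 1) / (2 * k%:R + 1)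
  else 0.

Definition mxC : infmx K := fun k j => mxA k j - mxB k j.

End InfiniteMatrices.

Section RightHandSide.
Context {R : realType}.
Implicit Types (z : R[i]) (k j : nat).

Definition lambda k z : R[i] :=
  match k with
  | 0 => (z - 1) * clog (z - 1) + (z + 1) * clog (z + 1)
  | 1 => - (2 / 3)
  | _ => 0
  end.

Definition mu_m k z : R[i] :=
  match k with
  | 0 => (z - 'i%C) * clog (z - 'i%C) + (z + 'i%C) * clog_ (z + 'i%C)
  | 1 => - (2 * 'i%C / 3)
  | _ => 0
  end.

Definition mu_n k z : R[i] :=
  if (Re z < 0) && (-1 < Im z < 1)
  then 2 * 'i%C * (pi * Re z * ultra_m12 k.+1 (Im z))%:C
  else 0.

Definition mu k z : R[i] := mu_m k z - mu_n k z.

Definition b_square k (x : R) : R :=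
  ultra_m32 k.+2 x / 3 - (k == 0)%:R * x + (k == 1)%:R / 3.

Definition b_left k (x : R) : R :=
  - (2 * x * (k == 0)%:R) + 2 * (k == 1)%:R / 3.

Definition b k z : R :=
  if (-1 <= Re z <= 1) && (-1 <= Im z <= 1) then b_square k (Re z)
  else if (Re z < -1) && (-1 < Im z < 1) then b_left k (Re z)
  else 0.

(* The matrix equation with right-hand side F (built from b) fails exactly on
   [edge]: e.g. at z = i the (0, 0) entries differ by i pi. L(z) is continuous
   in z, and the principal branch (arg = pi on the cut) makes the terms lambda
   and L1 at y = 1 (resp. y = -1) continuous from above, so the beta term must
   be absent at y = 1 and present at y = -1: both regions of b_corr are cut
   along -1 <= y < 1. b and b_corr agree off [edge]; at z = 1 + i because
   b_square k 1 = 0, as (1 - r)^3 = 1 - 3 r + 3 r^2 - r^3. *)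
Definition b_corr k z : R :=
  if -1 <= Im z < 1 then
    if -1 <= Re z <= 1 then b_square k (Re z)
    else if Re z < -1 then b_left k (Re z)
    else 0
  else 0.

Definition edge z : bool :=
  ((Im z == 1) && (-1 <= Re z < 1)) || ((Im z == -1) && (Re z < -1)).

Definition beta_of (bz : nat -> R[i] -> R) k j z : R[i] :=
  2 * 'i%C * (pi * ultra_m12 j.+1 (Im z) * bz k z)%:C.

Definition F1 z : infmx R[i] := fun k j =>
  match k, j with
  | 0, _ =>
      'i%C * (M1 j.+1 (z - 1) + M1 j.+1 (z + 1)
            - pred_entry (M1^~ (z - 1)) j - pred_entry (M1^~ (z + 1)) j)
        / (2 * j%:R + 1)
      + mu j (z - 1) + mu j (z + 1)
  | 1, 0 => - (4 / 3)
  | _, _ => 0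
  end.

Definition F2_of (bz : nat -> R[i] -> R) z : infmx R[i] := fun k j =>
  match k, j with
  | _, 0 =>
      (L1 k.+1 (z - 'i%C) + L1 k.+1 (z + 'i%C)
       - pred_entry (L1^~ (z - 'i%C)) k - pred_entry (L1^~ (z + 'i%C)) k)
        / (2 * k%:R + 1)
      + lambda k (z - 'i%C) + lambda k (z + 'i%C) + beta_of bz k 0 z
  | 0, 1 => - (4 * 'i%C / 3) + beta_of bz 0 1 z
  | _, _ => beta_of bz k j z
  end.

Definition F z : infmx R[i] := fun k j => F2_of b z k j - F1 z k j.

Definition F_corr z : infmx R[i] := fun k j => F2_of b_corr z k j - F1 z k j.

End RightHandSide.

(* Main.v *)
Require Import Defs.
From HB Require Import structures.
From mathcomp Require Import all_boot all_order all_algebra.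
From mathcomp Require Import all_classical all_reals all_analysis.
From mathcomp Require Import complex measurable_realfun.
From mathcomp Require Import ring lra zify.

Import Order.TTheory GRing.Theory Num.Theory.
Import numFieldNormedType.Exports.
Local Open Scope classical_set_scope.
Local Open Scope ring_scope.
Local Open Scope complex_scope.

(** Write [W_k] for the polynomial with [(2k+1) W_k = P_(k+1) - P_(k-1)], a
    primitive of the Legendre polynomial [P_k], and [w = z - (s + i t)]. As the
    row [k] of [C] takes this difference, [C L] and [L C^T] have the entries
    [\iint log w W_k(s) P_j(t)] and [\iint log w P_k(s) W_j(t)]. With [f = W_k] and
    [g = W_j] the left-hand side is therefore the single integral
    [\iint log w (f g' - i f' g)].

    The function [A(w) = w log w - w] is an antiderivative of [log], so that
    [d/ds A = - log w] and [d/dt A = - i log w] off the cut, and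
    [(f g' - i f' g) log w = f' d/dt (g A) - g' d/ds (f A)]. Integrating the first
    term first in [t], the second one first in [s], and then each boundary term by
    parts once more, leaves integrals of [log w] against [f] or [g] over the four
    edges of the square, while the corner values of [A] cancel. This is
    [Green_square], applied to the real and to the imaginary part of [A]. As [W_k]
    vanishes at [1] and [-1] for [k > 0] and [W_0 = X], only row [0] and column [0]
    receive an edge integral, and these are the quotients of [L_k] or [M_j] in the
    two parts of [F].

    The imaginary part of [A] jumps by [2 pi (x - s)] across the cut. On the
    vertical line through [s > x], the cut is met at [t = y], and this adds
    [2 pi f'(s) g(y) (x - s)] to the integrand of the outer integral. One more
    integration by parts expresses the sum of these terms through a primitive [V_k]
    of [W_k] ([Green_Im]). Now [- W_j] is an ultraspherical polynomial of parameter
    [-1/2] and [3 V_k] one of parameter [-3/2], up to low-degree corrections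
    ([ultra_m12E], [b_squareE]), so that the jump is the sum of [beta_kj] and, for
    [k = 0], of the terms [n_j]. The remaining terms of [F] are the values
    [w log w] at the corners. They enter with opposite signs through [lambda_0] and
    [m_0] and cancel, except that [log] and [log_-] differ at [y = - 1]; that
    difference belongs to the jump ([log_corners]). The constants in [lambda_1]
    and [m_1] cancel the constants of [F] at the positions (1,0) and (0,1).

    Two points need care, as [z] may lie in the square or on its boundary. Each
    integration by parts meets at most one bad point of its line, where the
    antiderivative remains continuous; [FTC_but_one] covers this once the integrand
    is known to be integrable. Integrability and Fubini follow from the bound
    [|log w| <= C (1 + |ln |x - s|| + |ln |y - t||)] on the square ([dom_lnr]), a
    finite sum of integrable functions of one variable.

    The ultraspherical identities hold because all polynomials involved, but
    for a few of low degree, are multiples of derivatives of [(X^2 - 1)^k]: these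
    satisfy, by [rodrigues_three_term], the recurrence that the Taylor coefficients
    of [(1 - 2 x r + r^2)^(- lam)] satisfy.

    Finally, off its row [0] and column [0] the matrix [F] is a rank one matrix, the
    product of a column depending on [k] and a row depending on [j]; hence the
    rank is at most [3]. *)

(** * Legendre polynomials and their primitives *)

(** The common source of all polynomials below: [P_k] is the case [n = k], its
    iterated primitives vanishing at [1] and [-1] are the cases [n < k], its derivatives
    the cases [n > k]. Locked, because conversion must not unfold iterated derivatives. *)
HB.lock Definition rodrigues (R : realType) (k n : nat) : {poly R} :=
  (2 ^+ k * k`!%:R)^-1 *: (('X^2 - 1) ^+ k)^`(n).
Arguments rodrigues {R} k n.

Section RodriguesPolynomials.
Context {R : realType}.
Implicit Types (k n m : nat) (p q r : {poly R}).
Local Notation rodrigues := (@rodrigues R).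

Lemma legendreE k : legendre k = rodrigues k k :> {poly R}.
Proof. by rewrite unlock. Qed.

Lemma deriv_rodrigues k n : (rodrigues k n)^`() = rodrigues k n.+1.
Proof. by rewrite unlock derivZ derivnS. Qed.

Lemma derivn_rodrigues k n m : (rodrigues k n)^`(m) = rodrigues k (m + n).
Proof. by elim: m => [|m IHm]; rewrite ?derivn0// derivnS IHm deriv_rodrigues. Qed.

Lemma derivnMX p n : (p * 'X)^`(n.+1) = p^`(n.+1) * 'X + p^`(n) *+ n.+1.
Proof. by have := derivnMXaddC n p 0; rewrite addr0 addrC. Qed.

Lemma rodrigues_norm k :
  (2 ^+ k.+1 * k.+1`!%:R)^-1 * (k.+1%:R * 2) = (2 ^+ k * k`!%:R)^-1 :> R.
Proof.
rewrite factS natrM exprS.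
have h1 : k`!%:R != 0 :> R by rewrite pnatr_eq0 -lt0n fact_gt0.
have h2 : 2 ^+ k != 0 :> R by rewrite expf_neq0// pnatr_eq0.
have h3 : k.+1%:R != 0 :> R by rewrite pnatr_eq0.
by field; rewrite h1 h2 nat1r h3.
Qed.

Lemma deriv_pow_sqr_sub1 k :
  (('X^2 - 1 : {poly R}) ^+ k.+1)^`() = (k.+1%:R * 2) *: (('X^2 - 1) ^+ k * 'X).
Proof.
rewrite deriv_exp derivB derivXn derivC subr0 /= expr1 -mulr_natr -mulr_natr.
by rewrite -mul_polyC polyCM -!polyC_natr; ring.
Qed.

(** Leibniz' rule for [(q^(k+1))' = 2 (k+1) q^k X] with [q = X^2 - 1]: only two
    terms survive because [X] has degree one. *)
Lemma rodriguesS k n :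
  rodrigues k.+1 n.+1 = rodrigues k n * 'X + rodrigues k n.-1 *+ n.
Proof.
rewrite unlock derivSn deriv_pow_sqr_sub1 derivnZ scalerA rodrigues_norm.
case: n => [|n]; first by rewrite !derivn0 mulr0n addr0 scalerAl.
by rewrite derivnMX scalerDr scalerAl scalerMnr.
Qed.

Lemma rodriguesS0 k :
  rodrigues k.+1 0 *+ (2 * k.+1) = rodrigues k 0 * ('X^2 - 1).
Proof.
rewrite unlock !derivn0 -scaler_nat scalerA mulrC natrM [2%:R * _]mulrC.
by rewrite rodrigues_norm exprSr scalerAl.
Qed.

(** It suffices to take two derivatives of [q^(k+2)], [q = X^2 - 1], and to replace
    [X^2] by [q + 1]; further derivatives are free. *)
Lemma rodrigues_contiguous k n :
  rodrigues k.+2 n.+2 = rodrigues k.+1 n *+ (2 * k.+1).+1 + rodrigues k n.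
Proof.
have h : rodrigues k.+2 2 = rodrigues k.+1 0 *+ (2 * k.+1).+1 + rodrigues k 0.
  have -> : rodrigues k.+2 2 = rodrigues k.+1 1 * 'X + rodrigues k.+1 0.
    exact: rodriguesS.
  rewrite mulrS rodriguesS0 (_ : rodrigues k.+1 1 = rodrigues k 0 * 'X); last first.
    by rewrite rodriguesS mulr0n addr0.
  by ring.
have := congr1 (derivn n) h.
by rewrite derivnD derivnMn !derivn_rodrigues addn2 addn0.
Qed.

(** Along a line of constant [k - n], which is a line of constant ultraspherical
    parameter, [rodriguesS] and [rodrigues_contiguous] combine into the recurrence of
    the Gegenbauer polynomials. *)
Lemma rodrigues_three_term k n :
  (2 * k%:R + 2 - n%:R) *: rodrigues k.+2 n.+2 =
  (2 * k%:R + 3) *: (rodrigues k.+1 n.+1 * 'X) - n.+1%:R *: rodrigues k n.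
Proof.
have hA : rodrigues k.+2 n.+2 =
    rodrigues k.+1 n.+1 * 'X + n.+1%:R * rodrigues k.+1 n.
  by rewrite rodriguesS mulr_natl.
have -> : rodrigues k n =
    rodrigues k.+2 n.+2 - (2 * k%:R + 3) * rodrigues k.+1 n.
  have e : (2 * k.+1).+1%:R = 2 * k%:R + 3 :> {poly R}.
    by rewrite -natr1 natrM -natr1; ring.
  by rewrite rodrigues_contiguous -[rodrigues _ _ *+ _]mulr_natl e; ring.
rewrite hA -!mul_polyC !(polyCD, polyCN, polyCM, polyC_natr) -(natr1 n).
ring.
Qed.

(** The shape of the equation is stable under differentiation, which makes it the
    induction step of [rodrigues_ode]. *)
Lemma deriv_sqr_sub1_eq (a b : R) p q r :
  ('X^2 - 1) * p = a *: ('X * q) + b *: r -> q^`() = p ->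
  ('X^2 - 1) * p^`() = (a - 2) *: ('X * p) + a *: q + b *: r^`().
Proof.
move=> /(congr1 deriv) + qp; rewrite derivD !derivZ !derivM qp.
rewrite derivB derivXn derivC subr0 derivX /= mul1r => h.
apply: (addrI ('X^1 *+ 2 * p)); rewrite h scalerBl scaler_nat scalerDr; ring.
Qed.

(** Iterated derivative of the first order equation [(X^2 - 1) u' = 2 k X u] of
    [u = (X^2 - 1)^k]. For [n = k - 1] the middle term disappears, which expresses
    [(1 - X^2) P_k'] by a primitive of [P_k]. *)
Lemma rodrigues_ode k n :
  ('X^2 - 1) * rodrigues k n.+2 =
  (2 * k%:R - 2 * n.+1%:R) *: ('X * rodrigues k n.+1)
  + ((2 * k%:R - n%:R) * n.+1%:R) *: rodrigues k n.
Proof.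
have h0 : ('X^2 - 1) * rodrigues k 1 = (2 * k%:R) *: ('X * rodrigues k 0).
  case: k => [|k].
    rewrite mulr0 scale0r [rodrigues 0 1](_ : _ = 0) ?mulr0//.
    by rewrite unlock expr0 derivnC scaler0.
  have -> : rodrigues k.+1 1 = rodrigues k 0 * 'X.
    by rewrite rodriguesS mulr0n addr0.
  rewrite mulrCA mulrA -rodriguesS0 -[rodrigues _ _ *+ _]scaler_nat natrM.
  by rewrite -scalerAl ['X * _]mulrC.
elim: n => [|n IHn].
  rewrite -[_ *: ('X * _)]addr0 -(scale0r 0) in h0.
  have := deriv_sqr_sub1_eq _ _ _ _ _ h0 (deriv_rodrigues _ _).
  rewrite !deriv_rodrigues => ->; rewrite scale0r addr0.
  by congr (_ *: _ + _ *: _); ring.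
have := deriv_sqr_sub1_eq _ _ _ _ _ IHn (deriv_rodrigues _ _).
rewrite !deriv_rodrigues => ->; rewrite -addrA -scalerDl.
by congr (_ *: _ + _ *: _); ring.
Qed.

(** Each differentiation costs at most one factor [q]. *)
Lemma derivn_pow_factor q r k n : (n <= k)%N ->
  exists s, (q ^+ k * r)^`(n) = q ^+ (k - n) * s.
Proof.
elim: n => [_|n IHn nk]; first by exists r; rewrite derivn0 subn0.
have [s ks] := IHn (ltnW nk).
exists (q^`() * s *+ (k - n.+1).+1 + q * s^`()).
rewrite derivnS ks derivM deriv_exp -(subnSK nk) /= exprS; ring.
Qed.

Lemma rodrigues_root k n (x : R) : (n < k)%N -> x ^+ 2 = 1 ->
  (rodrigues k n).[x] = 0.
Proof.
move=> nk x1; rewrite unlock -[('X^2 - 1) ^+ k]mulr1.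
have [s ->] := derivn_pow_factor ('X^2 - 1) 1 _ _ (ltnW nk).
have q0 : ('X^2 - 1).[x] = 0 by rewrite !hornerE x1 subrr.
by rewrite -(subnSK nk) exprS hornerZ !hornerM q0 !mul0r mulr0.
Qed.

(** For [k > 0] the primitive that vanishes at [1] and [-1]. For [k = 0] no primitive
    does, and ['X] is the one that keeps [legendre_primitive_diff] uniform in [k]. *)
Definition legendre_primitive k : {poly R} :=
  if k is k'.+1 then rodrigues k k' else 'X.

Lemma legendre0 : legendre 0 = 1 :> {poly R}.
Proof. by rewrite /legendre expr0 derivn0 fact0 expr0 mulr1 invr1 scale1r. Qed.

Lemma deriv_legendre_primitive k : (legendre_primitive k)^`() = legendre k.
Proof. by case: k => [|k]; rewrite ?derivX ?legendre0 ?legendreE ?deriv_rodrigues. Qed.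

Lemma legendre_primitive_diff k :
  legendre k.+1 - (if k is k'.+1 then legendre k' else 0) =
  (2 * k%:R + 1) *: legendre_primitive k.
Proof.
case: k => [|k].
  rewrite subr0 mulr0 add0r scale1r legendreE rodriguesS mulr0n addr0.
  by rewrite -legendreE legendre0 mul1r.
rewrite !legendreE rodrigues_contiguous addrK /=.
by rewrite -scaler_nat -addn1 natrD natrM.
Qed.

Lemma legendre_primitive1 k : (legendre_primitive k).[1] = (k == 0)%:R.
Proof. by case: k => [|k]; rewrite ?hornerX//= rodrigues_root ?expr1n. Qed.

Lemma legendre_primitiveN1 k : (legendre_primitive k).[-1] = - (k == 0)%:R.
Proof. by case: k => [|k]; rewrite ?hornerX//= rodrigues_root ?oppr0// sqrrN expr1n. Qed.

Lemma rodrigues00 : rodrigues 0 0 = 1 :> {poly R}.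
Proof. by rewrite -legendreE legendre0. Qed.

Lemma rodrigues11 : rodrigues 1 1 = 'X :> {poly R}.
Proof. by rewrite rodriguesS rodrigues00 mulr0n addr0 mul1r. Qed.

Lemma horner_rodrigues0 k (y : R) :
  (rodrigues k 0).[y] = (y ^+ 2 - 1) ^+ k / (2 ^+ k * k`!%:R).
Proof.
rewrite unlock derivn0 hornerZ horner_exp -polyC1.
by rewrite !(hornerXn, hornerD, hornerN, hornerC) mulrC.
Qed.

End RodriguesPolynomials.

(** * Gegenbauer polynomials as Taylor coefficients *)

Section GegenbauerTaylor.
Context {R : realType}.
Implicit Types (n k : nat) (lam x : R).

Definition gegen_base x : {poly R} := 'X^2 - 2 * x%:P * 'X + 1.

(** The numerator of the [n]-th derivative of a power of [q = gegen_base x]: it equals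
    [gegen_num lam x n * q^(- lam - n)]. *)
Fixpoint gegen_num lam x n : {poly R} :=
  if n is n'.+1 then
    (gegen_num lam x n')^`() * gegen_base x
    - (lam%:P + n'%:R) * (gegen_base x)^`() * gegen_num lam x n'
  else 1.

Lemma deriv_nat n : (n%:R : {poly R})^`() = 0.
Proof. by rewrite -polyC_natr derivC. Qed.

Lemma deriv_gegen_base x : (gegen_base x)^`() = 2 * 'X - 2 * x%:P.
Proof.
rewrite /gegen_base derivD derivB derivXn !derivM derivX derivC deriv_nat derivC expr1.
by rewrite -mulr_natl; ring.
Qed.

(** Differentiating the defining recursion yields an expression in
    [(gegen_num lam x n)' * gegen_base x], which the recursion itself eliminates. *)
Lemma deriv_gegen_num lam x n : (gegen_num lam x n.+1)^`() =
  - (n.+1%:R * (n%:R + 2 * lam%:P)) * gegen_num lam x n.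
Proof.
elim: n => [|n IHn].
  rewrite /= derivC mul0r sub0r mulr1 derivN derivM deriv_gegen_base derivB.
  by rewrite !(derivM, derivD, derivX, derivC, deriv_nat); ring.
have E : gegen_num lam x n.+1 = (gegen_num lam x n)^`() * gegen_base x
    - (lam%:P + n%:R) * (gegen_base x)^`() * gegen_num lam x n by [].
rewrite [gegen_num lam x n.+2]/= -/(gegen_num lam x n.+1) IHn.
rewrite derivB !derivM !deriv_gegen_base IHn.
rewrite !(derivN, derivM, derivD, derivC, deriv_nat, derivX).
rewrite deriv_gegen_base in E.
have {}E : (gegen_num lam x n)^`() * gegen_base x = gegen_num lam x n.+1 +
  (lam%:P + n%:R) * (2 * 'X - 2 * x%:P) * gegen_num lam x n.
  by rewrite E subrK.
move: (gegen_num lam x n.+1) (gegen_num lam x n) E => p1 p0 E.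
rewrite -(natr1 n.+1) -(natr1 n).
(* Isolates the product to which [E] applies. *)
transitivity (- ((n%:R + 1) * (n%:R + 2 * lam%:P)) * (p0^`() * gegen_base x)
  + (- ((n%:R + 1) * (n%:R + 2 * lam%:P)) * p0) * (2 * 'X - 2 * x%:P)
  - (lam%:P + (n%:R + 1))
    * (2 * p1 + (2 * 'X - 2 * x%:P) * (- ((n%:R + 1) * (n%:R + 2 * lam%:P)) * p0))).
  by ring.
by rewrite E; ring.
Qed.

Definition gegen_coef lam n x : R := (gegen_num lam x n).[0] / n`!%:R.

(** The defining recursion at [r = 0], where [q = 1] and [q' = - 2 x]; the derivative
    in it is known from [deriv_gegen_num]. *)
Lemma gegen_coef_three_term lam n x :
  n.+2%:R * gegen_coef lam n.+2 x =
  2 * (n.+1%:R + lam) * x * gegen_coef lam n.+1 x - (n%:R + 2 * lam) * gegen_coef lam n x.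
Proof.
have e : (gegen_num lam x n.+2).[0] =
  2 * (n.+1%:R + lam) * x * (gegen_num lam x n.+1).[0]
    - n.+1%:R * (n%:R + 2 * lam) * (gegen_num lam x n).[0].
  have -> : gegen_num lam x n.+2 = (gegen_num lam x n.+1)^`() * gegen_base x
    - (lam%:P + n.+1%:R) * (gegen_base x)^`() * gegen_num lam x n.+1 by [].
  rewrite deriv_gegen_num deriv_gegen_base /gegen_base -!polyC_natr.
  rewrite !(hornerXn, hornerD, hornerN, hornerM, hornerC, hornerX) ?expr0n /=.
  by ring.
rewrite /gegen_coef e !factS !natrM.
have h1 : n`!%:R != 0 :> R by rewrite pnatr_eq0 -lt0n fact_gt0.
have h3 : n.+1%:R != 0 :> R by rewrite pnatr_eq0.
have h4 : n.+2%:R != 0 :> R by rewrite pnatr_eq0.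
by field; rewrite h1 nat1r h3 -natrD add2n h4.
Qed.

Lemma gegen_coef0 lam x : gegen_coef lam 0 x = 1.
Proof. by rewrite /gegen_coef /= hornerC fact0 divr1. Qed.

Lemma gegen_coef1 lam x : gegen_coef lam 1 x = 2 * lam * x.
Proof.
rewrite /gegen_coef [gegen_num _ _ _]/= derivC mul0r sub0r addr0 mulr1.
rewrite deriv_gegen_base -!polyC_natr factS fact0 muln1.
rewrite !(hornerD, hornerN, hornerM, hornerC, hornerX).
by field.
Qed.

(** Positivity of [q] holds on a neighbourhood of [r], so the formula for the [n]-th
    derivative can be differentiated there. *)
Lemma derive1n_gegen lam x n (r : R) : 0 < (gegen_base x).[r] ->
  derive1n n (fun r : R => (1 - 2 * x * r + r ^+ 2) `^ (- lam)) r =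
  (gegen_num lam x n).[r] * (gegen_base x).[r] `^ (- lam - n%:R).
Proof.
have qE (s : R) : (gegen_base x).[s] = 1 - 2 * x * s + s ^+ 2.
  rewrite /gegen_base -polyC_natr !(hornerXn, hornerD, hornerN, hornerM, hornerC, hornerX).
  ring.
elim: n r => [|n IHn] r r0.
  by rewrite derive1n0 /= hornerC mul1r subr0 qE.
rewrite derive1nS derive1E.
have near_q : \forall s \near r, 0 < (gegen_base x).[s].
  exact: (cvgr_gt _ (@continuous_horner R (gegen_base x) r) _ r0).
rewrite (near_eq_derive _
  (g := fun s => (gegen_num lam x n).[s] * (gegen_base x).[s] `^ (- lam - n%:R))); last first.
  by near=> s; apply: IHn; near: s.
have D1 := is_derive_poly (gegen_num lam x n) r.
have D2 := is_derive_poly (gegen_base x) r.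
have D3 := is_derive1_powR (- lam - n%:R) r0.
have D4 := is_derive1_comp D3 D2.
have /@derive_val -> := is_deriveM D1 D4.
rewrite /= /GRing.scale /=.
have e1 : (gegen_base x).[r] `^ (- lam - n%:R) =
    (gegen_base x).[r] `^ (- lam - n.+1%:R) * (gegen_base x).[r].
  rewrite -[X in _ * X]powRr1 ?ltW// -powRD ?(gt_eqF r0) ?implybT//.
  by congr (_ `^ _); rewrite -natr1; ring.
rewrite e1 -natr1 [- lam - _ - 1](_ : _ = - lam - (n%:R + 1)); last by ring.
by rewrite -polyC_natr !(hornerD, hornerN, hornerM, hornerC); ring.
Unshelve. all: by end_near. Qed.

Lemma gegenbauerE lam n x : gegenbauer lam n x = gegen_coef lam n x.
Proof.
have q0 : (gegen_base x).[0] = 1.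
  rewrite /gegen_base !(hornerXn, hornerD, hornerN, hornerM, hornerC, hornerX).
  by rewrite expr0n mulr0 oppr0 !add0r.
by rewrite /gegenbauer derive1n_gegen q0 ?ltr01// powR1 mulr1.
Qed.

End GegenbauerTaylor.

(** * Ultraspherical polynomials as derivatives and primitives *)

Section Ultraspherical.
Context {R : realType}.
Implicit Types (k j m : nat) (x y : R).

(** [C_m^(3/2)] is the derivative of [P_(m+1)]: both sides satisfy the same three-term
    recurrence with the same two initial values. *)
Lemma gegen_coef_32 m y : gegen_coef (3 / 2) m y = (rodrigues m.+1 m.+2).[y].
Proof.
have r12 : rodrigues 1 2 = 1 :> {poly R}.
  rewrite rodriguesS /= rodrigues00 mulr1n -[rodrigues 0 1]deriv_rodrigues rodrigues00.
  by rewrite derivC mul0r add0r.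
suff: gegen_coef (3 / 2) m y = (rodrigues m.+1 m.+2).[y] /\
  gegen_coef (3 / 2) m.+1 y = (rodrigues m.+2 m.+3).[y] by case.
elim: m => [|m [IH1 IH2]]; split => //.
- by rewrite gegen_coef0 r12 hornerC.
- rewrite gegen_coef1 rodriguesS /= r12 (_ : rodrigues 1 1 = 'X).
    by rewrite mul1r hornerD hornerMn hornerX; field.
  exact: rodrigues11.
- apply: (@mulfI _ m.+2%:R); first by rewrite pnatr_eq0.
  rewrite gegen_coef_three_term IH1 IH2.
  have := congr1 (horner^~ y) (rodrigues_three_term (R := R) m.+1 m.+2).
  rewrite !(hornerD, hornerN, hornerZ, hornerX, hornerM) => h.
  transitivity ((2 * m.+1%:R + 2 - m.+2%:R) * (rodrigues m.+3 m.+4).[y]).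
    by rewrite h -(natr1 m.+2) -(natr1 m.+1) -(natr1 m); field.
  by congr (_ * _); rewrite -(natr1 m.+1) -(natr1 m); ring.
Qed.

Lemma ultra_m12E j y : ultra_m12 j.+1 y = - (legendre_primitive j).[y].
Proof.
case: j => [|m]; first by rewrite /= hornerX.
rewrite /ultra_m12 gegenbauerE gegen_coef_32 /=.
have := congr1 (horner^~ y) (rodrigues_ode (R := R) m.+1 m).
rewrite subrr scale0r add0r -polyC1 !(hornerXn, hornerD, hornerN, hornerZ, hornerM, hornerC) => h.
have -> : (1 - y ^+ 2) * (rodrigues m.+1 m.+2).[y] =
  - ((m.+2%:R * m.+1%:R) * (rodrigues m.+1 m).[y]).
  rewrite -opprB mulNr h; congr (- (_ * _ * _)).
  by rewrite -(natr1 m.+1) -(natr1 m); ring.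
by rewrite mulNr mulrAC divff ?mul1r// mulf_neq0 ?pnatr_eq0.
Qed.

(** A primitive of [W_k], normalised at [1] so that its increment from [x] to [1] is
    minus its value at [x]. For [k > 1] it is again of Rodrigues type. *)
Definition legendre_primitive2 k : {poly R} :=
  match k with
  | 0 => (2^-1)%:P * ('X^2 - 1)
  | 1 => (6^-1)%:P * 'X^3 - (2^-1)%:P * 'X + (3^-1)%:P
  | m.+2 => rodrigues m.+2 m
  end.

(** For parameter [-3/2] the recurrence degenerates at low degree: the first four
    coefficients are not given by Rodrigues' formula, and this is where the two
    correction terms come from. From degree [4] on both sides obey the same recurrence. *)
Lemma gegen_coef_N32 m y :
  gegen_coef (- (3 / 2)) m.+2 y / 3 = (legendre_primitive2 m).[y]
    + (m == 0%N)%:R - (m == 1%N)%:R / 3.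
Proof.
have h n := gegen_coef_three_term (R := R) (- (3 / 2)) n y.
have c2 : gegen_coef (- (3 / 2)) 2 y = 3 / 2 * (y ^+ 2 + 1).
  apply: (@mulfI _ 2%:R); first by rewrite pnatr_eq0.
  by rewrite (h 0%N) gegen_coef1 gegen_coef0; field.
have c3 : gegen_coef (- (3 / 2)) 3 y = y ^+ 3 / 2 - 3 / 2 * y.
  apply: (@mulfI _ 3%:R); first by rewrite pnatr_eq0.
  by rewrite (h 1%N) c2 gegen_coef1; field.
have c4 : gegen_coef (- (3 / 2)) 4 y = 3 / 8 * (y ^+ 2 - 1) ^+ 2.
  apply: (@mulfI _ 4%:R); first by rewrite pnatr_eq0.
  by rewrite (h 2%N) c3 c2; field.
have c5 : gegen_coef (- (3 / 2)) 5 y = 3 / 8 * y * (y ^+ 2 - 1) ^+ 2.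
  apply: (@mulfI _ 5%:R); first by rewrite pnatr_eq0.
  by rewrite (h 3%N) c4 c3; field.
suff key i : gegen_coef (- (3 / 2)) i.+4 y = 3 * (rodrigues i.+2 i).[y].
  case: m => [|[|m]] /=; last by rewrite key; field.
    by rewrite c2 -polyC1 !(hornerXn, hornerD, hornerN, hornerM, hornerC); field.
  by rewrite c3 !(hornerXn, hornerX, hornerD, hornerN, hornerM, hornerC); field.
suff: gegen_coef (- (3 / 2)) i.+4 y = 3 * (rodrigues i.+2 i).[y] /\
  gegen_coef (- (3 / 2)) i.+1.+4 y = 3 * (rodrigues i.+3 i.+1).[y] by case.
elim: i => [|i [IH1 IH2]]; split => //.
- by rewrite c4 horner_rodrigues0 !factS fact0 !natrM; field.
- rewrite c5 rodriguesS mulr0n addr0 hornerM hornerX horner_rodrigues0.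
  by rewrite !factS fact0 !natrM; field.
- apply: (@mulfI _ i.+1.+1.+4%:R); first by rewrite pnatr_eq0.
  rewrite h IH1 IH2.
  have := congr1 (horner^~ y) (rodrigues_three_term (R := R) i.+2 i).
  rewrite !(hornerD, hornerN, hornerZ, hornerX, hornerM) => e.
  transitivity (3 * ((2 * i.+2%:R + 2 - i%:R) * (rodrigues i.+4 i.+2).[y])).
    by rewrite e -(natr1 i.+4) -(natr1 i.+3) -(natr1 i.+2) -(natr1 i.+1) -(natr1 i); field.
  rewrite mulrCA; congr (_ * _).
  rewrite -(natr1 i.+1.+4) -(natr1 i.+4) -(natr1 i.+3) -(natr1 i.+2) -(natr1 i.+1) -(natr1 i).
  by ring.
Qed.

Lemma b_squareE k x :
  b_square k x = (legendre_primitive2 k).[x] + (k == 0%N)%:R * (1 - x).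
Proof.
by rewrite /b_square /ultra_m32 gegenbauerE gegen_coef_N32; ring.
Qed.

Lemma deriv_legendre_primitive2 k :
  (legendre_primitive2 k)^`() = legendre_primitive k.
Proof.
case: k => [|[|m]] /=; last by rewrite deriv_rodrigues.
  rewrite derivM derivC mul0r add0r derivB derivXn derivC subr0 expr1.
  by rewrite -['X *+ 2]mulr_natl mulrA -polyC_natr -polyCM mulVf ?pnatr_eq0// mul1r.
rewrite derivD derivB derivM derivXn derivM !derivC derivX !mul0r !add0r addr0 mulr1.
rewrite -['X^2 *+ 3]mulr_natl mulrA -polyC_natr -polyCM (_ : 6^-1 * 3%:R = 2^-1); last by field.
rewrite rodrigues.unlock derivn0 expr1 expr1 mulr1 -mul_polyC; ring.
Qed.

Lemma legendre_primitive2_1 k : (legendre_primitive2 k).[1] = 0.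
Proof.
case: k => [|[|m]] /=; last by rewrite rodrigues_root ?expr1n// ltnW.
  by rewrite -polyC1 !(hornerXn, hornerX, hornerD, hornerN, hornerM, hornerC); field.
by rewrite !(hornerXn, hornerX, hornerD, hornerN, hornerM, hornerC); field.
Qed.

Lemma legendre_primitive2_N1 k :
  (legendre_primitive2 k).[-1] = (k == 1%N)%:R * (2 / 3).
Proof.
case: k => [|[|m]] /=; last by rewrite rodrigues_root ?sqrrN ?expr1n ?mul0r// ltnW.
  by rewrite -polyC1 !(hornerXn, hornerX, hornerD, hornerN, hornerM, hornerC); field.
by rewrite !(hornerXn, hornerX, hornerD, hornerN, hornerM, hornerC); field.
Qed.

End Ultraspherical.

(** * Modulus and argument *)

Section LogParts.
Context {R : realType}.
Implicit Types x y u : R.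

Definition lnr x y : R := ln (Num.sqrt (x ^+ 2 + y ^+ 2)).
Definition arg x y : R := carg (x +i* y).

Lemma clogE x y : clog (x +i* y) = lnr x y +i* arg x y.
Proof. by []. Qed.

Lemma ln_sqrt u : 0 <= u -> ln (Num.sqrt u) = ln u / 2.
Proof. by move=> u0; rewrite -powR12_sqrt// ln_powR mulrC. Qed.

Lemma lnrE x y : lnr x y = ln (x ^+ 2 + y ^+ 2) / 2.
Proof. by rewrite /lnr ln_sqrt// addr_ge0 ?sqr_ge0. Qed.

Lemma lnrC x y : lnr x y = lnr y x.
Proof. by rewrite /lnr addrC. Qed.

Lemma sin_atan u : sin (atan u) = u / Num.sqrt (1 + u ^+ 2).
Proof.
rewrite -cos_atan -[X in X * _](atanK u) /tan divfK//.
by rewrite cos_atan invr_eq0 gt_eqF// sqrtr_gt0 ltr_pwDl// sqr_ge0.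
Qed.

Lemma acos_eq x r phi : 0 < r -> 0 <= phi <= pi -> x = r * cos phi ->
  acos (x / r) = phi.
Proof.
by move=> r0 phipi ->; rewrite mulrAC divff ?gt_eqF// mul1r cosK.
Qed.

Lemma argN x y : y != 0 -> arg x (- y) = - arg x y.
Proof.
rewrite /arg /carg /= sqrrN oppr_ge0; case: ltgtP => // y0 _; last by rewrite opprK.
Qed.

Lemma sqr_scale x y : x != 0 -> x ^+ 2 + y ^+ 2 = x ^+ 2 * (1 + (y / x) ^+ 2).
Proof. by move=> x0; field. Qed.

Lemma sqrt_scale x y : x != 0 ->
  Num.sqrt (x ^+ 2 + y ^+ 2) = `|x| * Num.sqrt (1 + (y / x) ^+ 2).
Proof. by move=> x0; rewrite sqr_scale// sqrtrM ?sqr_ge0// sqrtr_sqr. Qed.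

Lemma sqrt1D_gt0 u : 0 < Num.sqrt (1 + u ^+ 2).
Proof. by rewrite sqrtr_gt0 ltr_pwDl// sqr_ge0. Qed.

(** Formula valid off the vertical axis. For fixed [y] its last term is locally
    constant in [x]; for fixed [x < 0] it jumps at [y = 0], which is the cut. *)
Lemma arg_atan_yx x y : x != 0 ->
  arg x y = atan (y / x) + (if x < 0 then (if y < 0 then - pi else pi) else 0).
Proof.
have pos y' : x != 0 -> 0 <= y' -> arg x y' = atan (y' / x) + (if x < 0 then pi else 0).
  move=> x0 y0; rewrite /arg /carg /= y0 sqrt_scale//.
  have pi0 := @pi_gt0 R; have a1 := atan_gtNpi2 (y' / x); have a2 := atan_ltpi2 (y' / x).
  have s0 := sqrt1D_gt0 (y' / x).
  apply: acos_eq; first by rewrite mulr_gt0// normr_gt0.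
    have [xn|xp] := ltP x 0.
      have : atan (y' / x) <= 0.
        by rewrite -(atan0 R) le_atan// mulr_ge0_le0// invr_le0 ltW.
      by move=> ?; apply/andP; split; lra.
    have : 0 <= atan (y' / x).
      by rewrite -(atan0 R) le_atan// divr_ge0.
    by move=> ?; apply/andP; split; lra.
  have [xn|xp] := ltP x 0.
    by rewrite cosDpi cos_atan ltr0_norm//; field; rewrite gt_eqF.
  by rewrite addr0 cos_atan ger0_norm//; field; rewrite gt_eqF.
move=> x0; have [y0|y0] := leP 0 y; first exact: pos.
rewrite -[y]opprK argN ?oppr_eq0 ?lt_eqF// pos ?oppr_ge0 ?ltW// mulNr atanN opprK.
by case: ifP => _; ring.
Qed.

(** Formula valid off the real axis, hence the one to differentiate in [y]. *)
Lemma arg_atan_xy x y : y != 0 ->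
  arg x y = (if y < 0 then - (pi / 2) else pi / 2) - atan (x / y).
Proof.
have pos y' : 0 < y' -> arg x y' = pi / 2 - atan (x / y').
  move=> y0; rewrite /arg /carg /= (ltW y0) addrC sqrt_scale ?gt_eqF// gtr0_norm//.
  have pi0 := @pi_gt0 R; have a1 := atan_gtNpi2 (x / y'); have a2 := atan_ltpi2 (x / y').
  have s0 := sqrt1D_gt0 (x / y').
  apply: acos_eq; first by rewrite mulr_gt0.
    by apply/andP; split; lra.
  rewrite -cosN opprB cosBpihalf sin_atan mulrA.
  by field; rewrite !gt_eqF.
move=> y0; have [yn|yp] := ltP y 0; last by rewrite pos// lt_neqAle eq_sym y0.
rewrite -[y in LHS]opprK argN ?oppr_eq0// pos ?oppr_gt0//.
by rewrite invrN mulrN atanN; ring.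
Qed.

Lemma arg_bound x y : `|arg x y| <= pi.
Proof.
have pi0 := @pi_gt0 R.
have [->|y0] := eqVneq y 0.
  have [->|x0] := eqVneq x 0.
    rewrite /arg /carg /= lexx mul0r acos0 ger0_norm ?divr_ge0 ?ltW//; lra.
  rewrite arg_atan_yx// mul0r atan0 add0r ltxx; case: ifP => _.
    by rewrite ger0_norm// ltW.
  by rewrite normr0 ltW.
rewrite arg_atan_xy// ler_norml.
have a1 := atan_gtNpi2 (x / y); have a2 := atan_ltpi2 (x / y).
by case: ifP => _; apply/andP; split; lra.
Qed.

End LogParts.

(** * The antiderivative of the logarithm *)

Section LogCalculus.
Context {R : realType}.
Implicit Types x y u : R.

Lemma is_derive_sqrD x y : is_derive x 1 (fun u : R => u ^+ 2 + y ^+ 2) (2 * x).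
Proof.
have D := is_deriveD (is_deriveX 2 (is_derive_id x (1 : R))) (is_derive_cst (y ^+ 2) x (1 : R)).
apply: (is_derive_eq D); rewrite /= addr0 /GRing.scale /= expr1; ring.
Qed.

Lemma sqrD_gt0 x y : (x != 0) || (y != 0) -> 0 < x ^+ 2 + y ^+ 2.
Proof.
move=> h; rewrite lt_neqAle addr_ge0 ?sqr_ge0// andbT eq_sym.
by rewrite paddr_eq0 ?sqr_ge0// !expf_eq0 /= negb_and.
Qed.

Lemma is_derive_lnr x y : (x != 0) || (y != 0) ->
  is_derive x 1 (fun u => lnr u y) (x / (x ^+ 2 + y ^+ 2)).
Proof.
move=> xy0; have r0 := sqrD_gt0 _ _ xy0.
have D1 := @is_derive1_comp R (@ln R) (fun u => u ^+ 2 + y ^+ 2) x _ _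
  (is_derive1_ln r0) (is_derive_sqrD x y).
have D2 := is_deriveZ (2^-1) D1.
rewrite (_ : (fun u => lnr u y) = (2^-1 \*: (@ln R \o (fun u : R => u ^+ 2 + y ^+ 2)))); last first.
  by apply/funext => u; rewrite lnrE mulrC.
apply: (is_derive_eq D2); rewrite /GRing.scale /=; field.
by rewrite gt_eqF.
Qed.

Lemma is_derive_atan_div x y : x != 0 ->
  is_derive x 1 (fun u => atan (y / u)) (- y / (x ^+ 2 + y ^+ 2)).
Proof.
move=> x0.
have D1 := is_deriveZ y (is_deriveV x0 (is_derive_id x (1 : R))).
have D2 := @is_derive1_comp R (@atan R) (y \*: (fun u => u^-1)) x _ _ (is_derive1_atan _) D1.
have r0 : x ^+ 2 + y ^+ 2 != 0 by rewrite gt_eqF// sqrD_gt0// x0.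
apply: (is_derive_eq D2); rewrite /= /GRing.scale /=; field.
by rewrite x0 r0.
Qed.

Lemma near_sgn x : x != 0 -> \forall u \near x, (u < 0) = (x < 0).
Proof.
move=> x0; have [xn|xp|x00] := ltgtP x 0; last by rewrite x00 eqxx in x0.
- by near=> u; near: u; exact: lt_nbhsl.
- near=> u; apply/negbTE; rewrite -leNgt ltW//; near: u; exact: lt_nbhsr.
Unshelve. all: by end_near. Qed.

Lemma near_neq0 x : x != 0 -> \forall u \near x, u != 0.
Proof.
move=> x0; have [xn|xp|x00] := ltgtP x 0; last by rewrite x00 eqxx in x0.
- by near=> u; rewrite lt_eqF//; near: u; exact: lt_nbhsl.
- by near=> u; rewrite gt_eqF//; near: u; exact: lt_nbhsr.
Unshelve. all: by end_near. Qed.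

Lemma is_derive_arg_x x y : x != 0 ->
  is_derive x 1 (fun u => arg u y) (- y / (x ^+ 2 + y ^+ 2)).
Proof.
move=> x0; pose c : R := if x < 0 then (if y < 0 then - pi else pi) else 0.
apply: (@near_eq_is_derive _ _ _ (fun u => atan (y / u) + c)).
  near=> u; rewrite arg_atan_yx /c.
    by have -> : (u < 0) = (x < 0) by near: u; exact: near_sgn.
  by near: u; exact: near_neq0.
have D := is_deriveD (is_derive_atan_div x y x0) (is_derive_cst c x (1 : R)).
by apply: (is_derive_eq D); rewrite addr0.
Unshelve. all: by end_near. Qed.

Lemma is_derive_arg_y x y : y != 0 ->
  is_derive y 1 (fun u => arg x u) (x / (x ^+ 2 + y ^+ 2)).
Proof.
move=> y0; pose c : R := if y < 0 then - (pi / 2) else pi / 2.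
apply: (@near_eq_is_derive _ _ _ (fun u => c - atan (x / u))).
  near=> u; rewrite arg_atan_xy /c.
    by have -> : (u < 0) = (y < 0) by near: u; exact: near_sgn.
  by near: u; exact: near_neq0.
have D := is_deriveB (is_derive_cst c y (1 : R)) (is_derive_atan_div y x y0).
by apply: (is_derive_eq D); rewrite sub0r addrC mulNr opprK.
Unshelve. all: by end_near. Qed.

(** Real part of the antiderivative [w log w - w] of [log w], for [w = x + i y]. *)
Definition potRe x y : R := x * lnr x y - y * arg x y - x.
(** Imaginary part of [w log w - w]. *)
Definition potIm x y : R := x * arg x y + y * lnr x y - y.

Lemma is_derive_potRe_x x y : x != 0 ->
  is_derive x 1 (fun u => potRe u y) (lnr x y).
Proof.
move=> x0; have xy0 : (x != 0) || (y != 0) by rewrite x0.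
have r0 : x ^+ 2 + y ^+ 2 != 0 by rewrite gt_eqF// sqrD_gt0.
have D1 := is_deriveM (is_derive_id x (1 : R)) (is_derive_lnr _ _ xy0).
have D2 := is_deriveZ y (is_derive_arg_x x y x0).
have D := is_deriveB (is_deriveB D1 D2) (is_derive_id x (1 : R)).
apply: (is_derive_eq D); rewrite /GRing.scale /=; field.
by rewrite r0.
Qed.

Lemma is_derive_potIm_x x y : x != 0 ->
  is_derive x 1 (fun u => potIm u y) (arg x y).
Proof.
move=> x0; have xy0 : (x != 0) || (y != 0) by rewrite x0.
have r0 : x ^+ 2 + y ^+ 2 != 0 by rewrite gt_eqF// sqrD_gt0.
have D1 := is_deriveM (is_derive_id x (1 : R)) (is_derive_arg_x x y x0).
have D2 := is_deriveZ y (is_derive_lnr _ _ xy0).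
have D := is_deriveB (is_deriveD D1 D2) (is_derive_cst y x (1 : R)).
apply: (is_derive_eq D); rewrite /GRing.scale /=; field.
by rewrite r0.
Qed.

Lemma is_derive_lnr_y x y : (x != 0) || (y != 0) ->
  is_derive y 1 (fun u => lnr x u) (y / (x ^+ 2 + y ^+ 2)).
Proof.
move=> xy0; rewrite (_ : (fun u => lnr x u) = (fun u => lnr u x)).
  by rewrite addrC; apply: is_derive_lnr; rewrite orbC.
by apply/funext => u; exact: lnrC.
Qed.

Lemma is_derive_potRe_y x y : y != 0 ->
  is_derive y 1 (fun u => potRe x u) (- arg x y).
Proof.
move=> y0; have xy0 : (x != 0) || (y != 0) by rewrite y0 orbT.
have r0 : x ^+ 2 + y ^+ 2 != 0 by rewrite gt_eqF// sqrD_gt0.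
have D1 := is_deriveM (is_derive_id y (1 : R)) (is_derive_arg_y x y y0).
have D2 := is_deriveZ x (is_derive_lnr_y _ _ xy0).
have D := is_deriveB (is_deriveB D2 D1) (is_derive_cst x y (1 : R)).
apply: (is_derive_eq D); rewrite /GRing.scale /=; field.
by rewrite r0.
Qed.

Lemma is_derive_potIm_y x y : y != 0 ->
  is_derive y 1 (fun u => potIm x u) (lnr x y).
Proof.
move=> y0; have xy0 : (x != 0) || (y != 0) by rewrite y0 orbT.
have r0 : x ^+ 2 + y ^+ 2 != 0 by rewrite gt_eqF// sqrD_gt0.
have D1 := is_deriveM (is_derive_id y (1 : R)) (is_derive_lnr_y _ _ xy0).
have D2 := is_deriveZ x (is_derive_arg_y x y y0).
have D := is_deriveB (is_deriveD D2 D1) (is_derive_id y (1 : R)).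
apply: (is_derive_eq D); rewrite /GRing.scale /=; field.
by rewrite r0.
Qed.

Lemma is_derive_continuous (f : R -> R) x l : is_derive x 1 f l -> {for x, continuous f}.
Proof. by move=> [d _]; apply/differentiable_continuous/derivable1_diffP. Qed.

Lemma continuous_mul_bounded (f g : R -> R) x (M : R) : f x = 0 -> {for x, continuous f} ->
  (forall u, `|g u| <= M) -> {for x, continuous (fun u => f u * g u)}.
Proof.
move=> fx0 cf gM; rewrite /prop_for /continuous_at fx0 mul0r.
apply: norm_cvg0.
have c0 : f u @[u --> x] --> (0 : R) by rewrite -fx0; exact: cf.
have c1 : `|f u| * M @[u --> x] --> (0 : R).
  by have := cvgM (cvg_norm c0) (cvg_cst M); rewrite normr0 mul0r; apply.
apply: squeeze_cvgr (cvg_cst (0 : R)) c1.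
by near=> u; rewrite /= normr_ge0 normrM ler_wpM2l.
Unshelve. all: by end_near. Qed.

(** From [ln v <= v] with [v = |x|^(-1/2)]. *)
Lemma mul_lnr_bound x : `|x| <= 1 -> `|x * lnr x 0| <= 2 * Num.sqrt `|x|.
Proof.
move=> x1; have [->|x0] := eqVneq x 0; first by rewrite mul0r normr0 mulr_ge0// sqrtr_ge0.
have nx0 : 0 < `|x| by rewrite normr_gt0.
have s0 : 0 < Num.sqrt `|x| by rewrite sqrtr_gt0.
have e : lnr x 0 = - (2 * ln (Num.sqrt `|x|)^-1).
  rewrite /lnr expr0n addr0 sqrtr_sqr lnV ?posrE// mulrN opprK ln_sqrt//; lra.
have l0 : 0 <= ln (Num.sqrt `|x|)^-1.
  rewrite ln_ge0// invf_ge1// -[leRHS]sqrtr1 ler_wsqrtr//.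
rewrite normrM e normrN [`|2 * _|]ger0_norm ?mulr_ge0//.
have l1 : ln (Num.sqrt `|x|)^-1 <= (Num.sqrt `|x|)^-1.
  by rewrite ltW// ln_sublinear// invr_gt0.
rewrite mulrCA ler_pM2l// -[X in X * _]sqr_sqrtr//.
apply: (@le_trans _ _ (Num.sqrt `|x| ^+ 2 * (Num.sqrt `|x|)^-1)).
  by rewrite ler_pM2l// exprn_gt0.
by rewrite expr2 mulfK// gt_eqF.
Qed.

Lemma continuous_mul_lnr0 : {for 0, continuous (fun u => u * lnr u 0)}.
Proof.
rewrite /prop_for /continuous_at mul0r; apply: norm_cvg0.
have c1 : 2 * Num.sqrt `|u| @[u --> (0 : R)] --> (0 : R).
  have c0 : `|u| @[u --> (0 : R)] --> (0 : R).
    by rewrite -[X in _ --> X](normr0 R); exact: norm_continuous.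
  have c2 : Num.sqrt `|u| @[u --> (0 : R)] --> (0 : R).
    have := cvg_comp _ _ c0 (@sqrt_continuous R 0); rewrite sqrtr0; exact.
  by have := cvgM (cvg_cst (2 : R)) c2; rewrite mulr0; apply.
apply: squeeze_cvgr (cvg_cst (0 : R)) c1.
near=> u; rewrite /= normr_ge0 mul_lnr_bound//.
Unshelve. all: by end_near. Qed.

End LogCalculus.

(** * The logarithm near its singularity and its cut *)

Section LogContinuity.
Context {R : realType}.
Implicit Types x y u : R.

Lemma continuous_arg_x x y : y != 0 -> {for x, continuous (fun u => arg u y)}.
Proof.
move=> y0; pose c : R := if y < 0 then - (pi / 2) else pi / 2.
have -> : (fun u => arg u y) = (fun u => c - atan (u / y)).
  by apply/funext => u; rewrite arg_atan_xy.
apply: (@cvgB _ _ _ (nbhs x)); first exact: cvg_cst.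
have h : u / y @[u --> x] --> x / y by apply: cvgM; [exact: cvg_id|exact: cvg_cst].
by have := cvg_comp _ _ h (@continuous_atan R (x / y)); exact.
Qed.

Lemma continuous_atan_div y x : x != 0 -> {for y, continuous (fun u => atan (u / x))}.
Proof.
move=> x0.
have h : u / x @[u --> y] --> y / x by apply: cvgM; [exact: cvg_id|exact: cvg_cst].
by have := cvg_comp _ _ h (@continuous_atan R (y / x)); exact.
Qed.

Lemma continuous_lnr_x x y : (x != 0) || (y != 0) -> {for x, continuous (fun u => lnr u y)}.
Proof. by move=> /is_derive_lnr; exact: is_derive_continuous. Qed.

Lemma continuous_lnr_y x y : (x != 0) || (y != 0) -> {for y, continuous (fun u => lnr x u)}.
Proof. by move=> /is_derive_lnr_y; exact: is_derive_continuous. Qed.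

Lemma continuous_potRe_x y : continuous (fun u => potRe u y).
Proof.
move=> x; have [->|x0] := eqVneq x 0; last first.
  exact: (is_derive_continuous _ _ _ (is_derive_potRe_x x y x0)).
rewrite /potRe; have [->|y0] := eqVneq y 0.
  apply: (@cvgB _ _ _ (nbhs (0 : R))); last exact: cvg_id.
  apply: (@cvgB _ _ _ (nbhs (0 : R))); first exact: continuous_mul_lnr0.
  by under eq_fun do rewrite mul0r; rewrite mul0r; exact: cvg_cst.
apply: (@cvgB _ _ _ (nbhs (0 : R))); last exact: cvg_id.
apply: (@cvgB _ _ _ (nbhs (0 : R))).
  by apply: (@cvgM _ _ (nbhs (0 : R))); [exact: cvg_id|apply: continuous_lnr_x; rewrite y0 orbT].
by apply: (@cvgM _ _ (nbhs (0 : R))); [exact: cvg_cst|exact: continuous_arg_x].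
Qed.

(** Horizontal lines do not cross the cut except at [w = 0], or run inside it when
    [y = 0]; the jump of [arg] at [w = 0] is absorbed by its factor [x]. *)
Lemma continuous_potIm_x y : continuous (fun u => potIm u y).
Proof.
move=> x; have [->|x0] := eqVneq x 0; last first.
  exact: (is_derive_continuous _ _ _ (is_derive_potIm_x x y x0)).
rewrite /potIm; apply: (@cvgB _ _ _ (nbhs (0 : R))); last exact: cvg_cst.
apply: (@cvgD _ _ _ (nbhs (0 : R))).
  apply: (continuous_mul_bounded id (fun u => arg u y) 0 pi) => //.
  by move=> u; exact: arg_bound.
have [->|y0] := eqVneq y 0.
  by under eq_fun do rewrite mul0r; rewrite mul0r; exact: cvg_cst.
by apply: (@cvgM _ _ (nbhs (0 : R))); [exact: cvg_cst|apply: continuous_lnr_x; rewrite y0 orbT].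
Qed.

Lemma continuous_potRe_y x : continuous (fun u => potRe x u).
Proof.
move=> y; have [->|y0] := eqVneq y 0; last first.
  exact: (is_derive_continuous _ _ _ (is_derive_potRe_y x y y0)).
rewrite /potRe; apply: (@cvgB _ _ _ (nbhs (0 : R))); last exact: cvg_cst.
apply: (@cvgB _ _ _ (nbhs (0 : R))); last first.
  apply: (continuous_mul_bounded id (fun u => arg x u) 0 pi) => //.
  by move=> u; exact: arg_bound.
have [->|x0] := eqVneq x 0.
  by under eq_fun do rewrite mul0r; rewrite mul0r; exact: cvg_cst.
by apply: (@cvgM _ _ (nbhs (0 : R))); [exact: cvg_cst|apply: continuous_lnr_y; rewrite x0].
Qed.

(** [potIm] continued across the cut from above: as [y] decreases through [0] with
    [x < 0], [arg] drops by [2 pi] and the correction restores it. *)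
Definition potIm_above x y : R :=
  potIm x y + (if (x < 0) && (y < 0) then 2 * pi * x else 0).

Lemma is_derive_potIm_above_y x y : y != 0 ->
  is_derive y 1 (fun u => potIm_above x u) (lnr x y).
Proof.
move=> y0; pose c : R := if (x < 0) && (y < 0) then 2 * pi * x else 0.
apply: (@near_eq_is_derive _ _ _ (fun u => potIm x u + c)).
  near=> u; rewrite /potIm_above /c.
  by have -> : (u < 0) = (y < 0) by near: u; exact: near_sgn.
have D := is_deriveD (is_derive_potIm_y x y y0) (is_derive_cst c y (1 : R)).
by apply: (is_derive_eq D); rewrite addr0.
Unshelve. all: by end_near. Qed.

(** By [arg_atan_yx], for [x < 0] the added term turns [arg x u] into
    [atan (u / x) + pi] on both sides of the cut. *)
Lemma continuous_potIm_above_y x : continuous (fun u => potIm_above x u).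
Proof.
move=> y; have [->|y0] := eqVneq y 0; last first.
  exact: (is_derive_continuous _ _ _ (is_derive_potIm_above_y x y y0)).
have [->|x0] := eqVneq x 0.
  rewrite (_ : (fun u => _) = (fun u => u * lnr u 0 - u)); last first.
    by apply/funext => u; rewrite /potIm_above /potIm ltxx mul0r add0r addr0 lnrC.
  by apply: (@cvgB _ _ _ (nbhs (0 : R))); [exact: continuous_mul_lnr0|exact: cvg_id].
pose c : R := if x < 0 then pi else 0.
rewrite (_ : (fun u => _) = (fun u => x * (atan (u / x) + c) + u * lnr x u - u)); last first.
  apply/funext => u; rewrite /potIm_above /potIm arg_atan_yx// /c.
  by case: (x < 0); case: (u < 0) => /=; ring.
apply: (@cvgB _ _ _ (nbhs (0 : R))); last exact: cvg_id.
apply: (@cvgD _ _ _ (nbhs (0 : R))).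
  apply: (@cvgM _ _ (nbhs (0 : R))); first exact: cvg_cst.
  apply: (@cvgD _ _ _ (nbhs (0 : R))); last exact: cvg_cst.
  exact: continuous_atan_div.
apply: (@cvgM _ _ (nbhs (0 : R))); first exact: cvg_id.
by apply: continuous_lnr_y; rewrite x0.
Qed.

(** If [|w| <= 1] then [|ln |w|| <= |ln |x||] because [|x| <= |w|]; otherwise
    [ln |w|] is bounded. If [x = 0] or [y = 0], the left-hand side is one of the terms
    on the right. *)
Lemma lnr_bound (K : R) x y : `|x| <= K -> `|y| <= K ->
  `|lnr x y| <= K ^+ 2 + `|lnr x 0| + `|lnr 0 y|.
Proof.
move=> xK yK.
have K0 : 0 <= K ^+ 2 by rewrite sqr_ge0.
have e0 : lnr 0 0 = 0 :> R by rewrite /lnr expr0n addr0 sqrtr0 ln0.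
have [->|x0] := eqVneq x 0.
  by rewrite e0 normr0 addr0 lerDr.
have [->|y0] := eqVneq y 0.
  by rewrite e0 normr0 addr0 lerDr.
have x2 : x ^+ 2 <= K ^+ 2 by rewrite -real_normK ?num_real// ler_sqr ?nnegrE// (le_trans _ xK).
have y2 : y ^+ 2 <= K ^+ 2 by rewrite -real_normK ?num_real// ler_sqr ?nnegrE// (le_trans _ yK).
have px : 0 < x ^+ 2 by rewrite exprn_even_gt0.
have py : 0 < y ^+ 2 by rewrite exprn_even_gt0.
have pr : 0 < x ^+ 2 + y ^+ 2 by rewrite addr_gt0.
have [r1|r1] := leP (x ^+ 2 + y ^+ 2) 1.
  have l1 : lnr x y <= 0 by rewrite lnrE pmulr_lle0// ln_le0.
  have l2 : lnr x 0 <= lnr x y.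
    by rewrite !lnrE ler_pM2r// ler_ln ?posrE// expr0n /= addr0 ?lerDl// ltW.
  rewrite ler0_norm// (@le_trans _ _ `|lnr x 0|)//.
    by rewrite ler0_norm ?lerN2// (le_trans l2).
  by rewrite addrAC lerDr addr_ge0.
have l1 : 0 <= lnr x y by rewrite lnrE divr_ge0// ln_ge0// ltW.
have l2 : lnr x y <= K ^+ 2.
  rewrite lnrE; have := ln_sublinear pr; move: x2 y2; lra.
by rewrite ger0_norm// (le_trans l2)// -addrA lerDl addr_ge0.
Qed.

Notation RR := (measurableTypeR R * measurableTypeR R)%type.

Section Measurability.
Variables (f g : RR -> R).
Hypotheses (mf : measurable_fun [set: RR] f) (mg : measurable_fun [set: RR] g).

Lemma measurable_lnr : measurable_fun [set: RR] (fun p => lnr (f p) (g p)).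
Proof.
under eq_fun do rewrite lnrE.
apply: measurable_funM; last exact: measurable_cst.
apply: (measurableT_comp (@measurable_ln R)).
by apply: measurable_funD; exact: measurable_funX.
Qed.

Lemma measurable_pos_div : measurable_fun [set: RR] (fun p => f p * (g p) `^ (-1)).
Proof.
apply: measurable_funM => //.
exact: (measurableT_comp (@measurable_powR R (-1))).
Qed.
End Measurability.

(** Case distinction on the signs, with measurable pieces. Inverses are written as
    powers because these are measurable on the whole line. *)
Lemma measurable_arg (f g : RR -> R) :
  measurable_fun [set: RR] f -> measurable_fun [set: RR] g ->
  measurable_fun [set: RR] (fun p => arg (f p) (g p)).
Proof.
move=> mf mg.
have matan := continuous_measurable_fun (@continuous_atan R).
have mcst (c : R) : measurable_fun [set: RR] (fun=> c) by exact: measurable_cst.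
rewrite (_ : (fun p => _) = (fun p =>
  if 0 < g p then pi / 2 - atan (f p * (g p) `^ (-1)) else
  if g p < 0 then - (pi / 2) + atan (f p * (- g p) `^ (-1)) else
  if f p < 0 then pi else if 0 < f p then 0 else pi / 2)); last first.
  apply/funext => p; case: ltgtP => g0.
  - by rewrite powR_inv1 ?ltW// arg_atan_xy ?gt_eqF// ltNge ltW.
  - rewrite powR_inv1 ?oppr_ge0 ?ltW// arg_atan_xy ?lt_eqF// g0 invrN mulrN atanN.
    by [].
  - rewrite -g0; case: ltgtP => f0.
    + by rewrite arg_atan_yx ?lt_eqF// mul0r atan0 f0 ltxx add0r.
    + by rewrite arg_atan_yx ?gt_eqF// mul0r atan0 ltNge ltW// add0r.
    + by rewrite f0 /arg /carg /= lexx mul0r acos0.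
apply: measurable_fun_ifT; first exact: measurable_fun_ltr.
  apply: measurable_funB => //; apply: (measurableT_comp matan).
  exact: measurable_pos_div.
apply: measurable_fun_ifT; first exact: measurable_fun_ltr.
  apply: measurable_funD => //; apply: (measurableT_comp matan).
  by apply: measurable_pos_div => //; exact: measurableT_comp.
apply: measurable_fun_ifT; first exact: measurable_fun_ltr.
  exact: mcst.
by apply: measurable_fun_ifT; first exact: measurable_fun_ltr.
Qed.

End LogContinuity.

(** * The fundamental theorem of calculus with one singular point *)

Section SingularFTC.
Context {R : realType}.
Notation mu := (@lebesgue_measure R).
Implicit Types (F h : R -> R) (a b c : R).

(** [F] minus the integral of [h] up to the current point is continuous on the closed
    interval and has derivative [0] inside, so the mean value theorem applies. *)
Lemma FTC_open_interval F h a b : a < b ->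
  {within `[a, b], continuous F} ->
  {in `]a, b[, forall t : R, is_derive t 1 F (h t)} ->
  {in `]a, b[, forall t : R, {for t, continuous h}} ->
  mu.-integrable `[a, b] (EFin \o h) ->
  \int[mu]_(t in `[a, b]) h t = F b - F a.
Proof.
move=> ab cF dF ch ih.
pose G x := F x - parameterized_integral mu a x h.
have cG : {within `[a, b], continuous G}.
  move=> x; apply: cvgB; first exact: cF.
  by have := parameterized_integral_continuous (ltW ab) ih; apply.
have dG x : x \in `]a, b[ -> is_derive x 1 G (cst 0 x).
  move=> xab; have := xab; rewrite in_itv /= => /andP[ax xb].
  have [d1 d2] := continuous_FTC1_closed xb ih ax (ch _ xab).
  have D : is_derive x 1 (fun y => parameterized_integral mu a y h) (h x).
    by apply: DeriveDef; [exact: d1|rewrite -derive1E].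
  have := is_deriveB (dF _ xab) D.
  by rewrite subrr.
have [x _] := MVT ab dG cG; rewrite mul0r => /eqP.
rewrite subr_eq0 /G /parameterized_integral set_itv1 Rintegral_set1 subr0 => /eqP <-.
by rewrite subKr.
Qed.

(** The singular point [c] may carry a jump, a kink or a blow-up of [h]. *)
Lemma FTC_but_one F h a b c : a <= b -> continuous F ->
  (forall t : R, t != c -> is_derive t 1 F (h t)) ->
  (forall t : R, t != c -> {for t, continuous h}) ->
  mu.-integrable `[a, b] (EFin \o h) ->
  \int[mu]_(t in `[a, b]) h t = F b - F a.
Proof.
rewrite le_eqVlt => /predU1P[<- *|ab cF dF ch ih].
  by rewrite set_itv1 Rintegral_set1 subrr.
have cFw u v : {within `[u, v], continuous F} by exact: continuous_subspaceT.
have [/andP[ac cb]|cab] := boolP (a < c < b); last first.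
  have ne t : t \in `]a, b[ -> t != c.
    by move=> tab; apply: contraNneq cab => <-; rewrite in_itv in tab.
  by apply: FTC_open_interval => // t /ne ?; [exact: dF|exact: ch].
have iac : mu.-integrable `[a, c] (EFin \o h).
  by apply: integrableS ih => //; apply: subset_itvl; rewrite bnd_simp ltW.
have icb : mu.-integrable `[c, b] (EFin \o h).
  by apply: integrableS ih => //; apply: subset_itvr; rewrite bnd_simp ltW.
have := @Rintegral_itvB _ h (BLeft a) (BRight b) c ih.
rewrite !bnd_simp => /(_ (ltW ac) (ltW cb)) /eqP.
rewrite Rintegral_itv_obnd_cbnd; last first.
  by apply: integrableS icb => //; exact: subset_itv_oc_cc.
rewrite subr_eq => /eqP ->.
rewrite (FTC_open_interval F _ _ _ cb)// ?(FTC_open_interval F _ _ _ ac)//.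
- by rewrite addrA subrK.
- by move=> t; rewrite in_itv /= => /andP[_ tc]; apply: dF; rewrite lt_eqF.
- by move=> t; rewrite in_itv /= => /andP[_ tc]; apply: ch; rewrite lt_eqF.
- by move=> t; rewrite in_itv /= => /andP[tc _]; apply: dF; rewrite gt_eqF.
- by move=> t; rewrite in_itv /= => /andP[tc _]; apply: ch; rewrite gt_eqF.
Qed.

(** Integrability comes from the primitive: on compact subintervals the integral is
    an increment of [F], and by monotone convergence these increments tend to the
    integral on the whole interval, which is thus finite. *)
Lemma ge0_integrable_open_interval F h a b : a < b -> continuous F ->
  {in `]a, b[, forall t : R, is_derive t 1 F (h t)} ->
  {in `]a, b[, forall t : R, {for t, continuous h}} ->
  measurable_fun [set: measurableTypeR R] h -> {in `[a, b], forall t, 0 <= h t} ->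
  mu.-integrable `[a, b] (EFin \o h).
Proof.
move=> ab cF dF ch mh h0.
(* The shift by 3 keeps [a + e n < b - e n] from [n = 0] on. *)
pose e n : R := (b - a) / n.+3%:R.
have e0 n : 0 < e n by rewrite divr_gt0// subr_gt0.
have e3 n : e n <= (b - a) / 3%:R.
  by rewrite ler_pM2l ?subr_gt0// lef_pV2 ?posrE// ler_nat.
have lt_ab n : a + e n < b - e n.
  by have := e3 n => ?; lra.
have decr m n : (m <= n)%N -> e n <= e m.
  by move=> mn; rewrite ler_pM2l ?subr_gt0// lef_pV2 ?posrE// ler_nat !ltnS.
pose E n := `[a + e n, b - e n]%classic.
have UE : \bigcup_n E n = `]a, b[%classic.
  rewrite eqEsubset; split=> t /=.
    move=> [n _]; rewrite /E /= !in_itv /= => /andP[h1 h2].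
    by have := e0 n => ?; apply/andP; split; lra.
  rewrite in_itv /= => /andP[at_ tb].
  pose m := Num.min (t - a) (b - t).
  have m0 : 0 < m by rewrite lt_min !subr_gt0 at_ tb.
  exists (Num.truncn ((b - a) / m)) => //; rewrite /E /= in_itv /=.
  have em : e (Num.truncn ((b - a) / m)) <= m.
    rewrite /e ler_pdivrMr// mulrC -ler_pdivrMr// (le_trans (ltW (truncnS_gt _)))//.
    by rewrite ler_nat ltnW.

  by move: em; rewrite le_min => /andP[? ?]; apply/andP; split; lra.
have ndE : nondecreasing_seq E.
  move=> m n mn; rewrite subsetEset => t; rewrite /E /= !in_itv /= => /andP[h1 h2].
  by have := decr _ _ mn; move=> ?; apply/andP; split; lra.
have mE (D : set R) : measurable D -> measurable_fun D h.
  by move=> mD; apply: measurable_funS mh.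
have cvgI := @ge0_nondecreasing_set_cvg_integral _ (measurableTypeR R) R E
  (fun t => (h t)%:E) mu ndE.
have {}cvgI : (\int[mu]_(t in E n) (h t)%:E)%E @[n --> \oo] -->
    (\int[mu]_(t in `]a, b[) (h t)%:E)%E.
  rewrite -UE; apply: cvgI => [i|i|i x].
  - exact: measurable_itv.
  - by apply/measurable_EFinP; apply: mE; exact: measurable_itv.
  - rewrite /E /= in_itv /= lee_fin => /andP[h1 h2]; apply: h0.
    by rewrite in_itv /=; have := e0 i => ?; apply/andP; split; lra.
have eE n : (\int[mu]_(t in E n) (h t)%:E)%E = (F (b - e n) - F (a + e n))%:E.
  have sub (t : R) : t \in `[a + e n, b - e n] -> t \in `]a, b[.
    by rewrite !in_itv /= => /andP[? ?]; have := e0 n => ?; apply/andP; split; lra.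
  have sub' (t : R) : t \in `]a + e n, b - e n[ -> t \in `]a, b[.
    by move=> /subset_itv_oo_cc /sub.
  rewrite EFinB (@continuous_FTC2 _ h F)//.
  - by apply: continuous_in_subspaceT => t; rewrite inE => /sub; exact: ch.
  - split => [t /sub' /dF []//||]; first exact/cvg_at_right_filter/cF.
    exact/cvg_at_left_filter/cF.
  - by move=> t /sub' /dF [_]; rewrite derive1E.
have e_cvg : e n @[n --> \oo] --> 0.
  rewrite -(mulr0 (b - a)); apply: cvgM; first exact: cvg_cst.
  have := @cvg_harmonic R; rewrite -(cvg_shiftn 2) /harmonic /=.
  by under eq_fun do rewrite addn2.
have cvgF : (F (b - e n) - F (a + e n))%:E @[n --> \oo] --> (F b - F a)%:E.
  apply: cvg_EFin; first exact: nearW.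
  have hb : (b - e n) @[n --> \oo] --> b.
    by rewrite -[X in _ --> X]subr0; apply: cvgB => //; exact: cvg_cst.
  have ha : (a + e n) @[n --> \oo] --> a.
    by rewrite -[X in _ --> X]addr0; apply: cvgD => //; exact: cvg_cst.
  by apply: cvgB; [exact: (cvg_comp _ _ hb (cF b))|exact: (cvg_comp _ _ ha (cF a))].
have IE : (\int[mu]_(t in `]a, b[) (h t)%:E)%E = (F b - F a)%:E.
  move: cvgI; rewrite (_ : (fun n => _) = (fun n => (F (b - e n) - F (a + e n))%:E)).
    by move=> cvgI; exact: (cvg_unique _ cvgI cvgF).
  by apply/funext => n; rewrite eE.
apply/integrableP; split; first by apply/measurable_EFinP; apply: mE; exact: measurable_itv.
rewrite integral_itv_bndoo; last first.
  by apply: measurableT_comp => //; apply/measurable_EFinP; apply: mE; exact: measurable_itv.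
rewrite (_ : (\int[_]_(_ in _) _)%E = (F b - F a)%:E) ?ltry//.
rewrite -IE; apply: eq_integral => t; rewrite inE /= => tab.
by rewrite ger0_norm// h0//; exact: subset_itv_oo_cc.
Qed.

(** [c] splits the interval into two pieces on which [h] has no singular point inside. *)
Lemma ge0_integrable_but_one F h a b c : a <= b -> continuous F ->
  (forall t : R, t != c -> is_derive t 1 F (h t)) ->
  (forall t : R, t != c -> {for t, continuous h}) ->
  measurable_fun [set: measurableTypeR R] h -> {in `[a, b], forall t, 0 <= h t} ->
  mu.-integrable `[a, b] (EFin \o h).
Proof.
rewrite le_eqVlt => /predU1P[<-|ab] cF dF ch mh h0.
  rewrite set_itv1; apply/integrableP; split; last by rewrite integral_set1.
  by apply/measurable_EFinP; apply: measurable_funS mh.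
have [/andP[ac cb]|cab] := boolP (a < c < b); last first.
  have ne t : t \in `]a, b[ -> t != c.
    by move=> tab; apply: contraNneq cab => <-; rewrite in_itv in tab.
  by apply: (ge0_integrable_open_interval F) => // t /ne ?; [exact: dF|exact: ch].
have /integrableP[_ iac] : mu.-integrable `[a, c] (EFin \o h).
  apply: (ge0_integrable_open_interval F) => // t.
  - by rewrite in_itv /= => /andP[_ tc]; apply: dF; rewrite lt_eqF.
  - by rewrite in_itv /= => /andP[_ tc]; apply: ch; rewrite lt_eqF.
  - rewrite in_itv /= => /andP[at_ tc]; apply: h0; rewrite in_itv /= at_ /=.
    exact: le_trans tc (ltW cb).
have /integrableP[_ icb] : mu.-integrable `]c, b] (EFin \o h).
  apply: (@integrableS _ _ _ mu `[c, b]) => //; first exact: subset_itv_oc_cc.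
  apply: (ge0_integrable_open_interval F) => // t.
  - by rewrite in_itv /= => /andP[tc _]; apply: dF; rewrite gt_eqF.
  - by rewrite in_itv /= => /andP[tc _]; apply: ch; rewrite gt_eqF.
  - rewrite in_itv /= => /andP[tc tb]; apply: h0; rewrite in_itv /= tb andbT.
    exact: le_trans (ltW ac) tc.
apply/integrableP; split.
  by apply/measurable_EFinP; apply: measurable_funS mh.
have mnh : measurable_fun [set: measurableTypeR R] (fun t => `|(EFin \o h) t|%E).
  by apply: measurableT_comp => //; exact/measurable_EFinP.
rewrite (@itv_bndbnd_setU _ _ _ (BRight c)) ?bnd_simp ?ltW//.
rewrite ge0_integral_setU//.
- by apply: lte_add_pinfty.
- by apply: (measurable_funS measurableT _ mnh).
- rewrite disj_set2E; apply/eqP; rewrite -subset0 => t /= [].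
  by rewrite !in_itv /= => /andP[_ tc] /andP[]; rewrite ltNge tc.
Qed.

End SingularFTC.

(** * Fubini for functions dominated by a sum of one-variable functions *)

Section Domination.
Context {R : realType}.
Notation mu := (@lebesgue_measure R).
Notation RR := (measurableTypeR R * measurableTypeR R)%type.
Variables phi psi : R -> R.
Hypothesis iphi : mu.-integrable (`[-1, 1] : set R) (EFin \o phi).
Hypothesis ipsi : mu.-integrable (`[-1, 1] : set R) (EFin \o psi).

(** The majorant is finite everywhere, so that every section at a point of the interval
    is integrable, and not only almost every one: the edges of the square are such
    sections. *)
Definition dominated (h : R -> R -> R) :=
  measurable_fun [set: RR] (fun p => h p.1 p.2) /\
  exists2 C : R, 0 <= C & {in `[-1, 1] &, forall s t : R, `|h s t| <= C * (1 + phi s + psi t)}.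

Lemma dominatedD h1 h2 : dominated h1 -> dominated h2 ->
  dominated (fun s t => h1 s t + h2 s t).
Proof.
move=> [m1 [C1 C10 h1C]] [m2 [C2 C20 h2C]]; split; first exact: measurable_funD.
exists (C1 + C2); first exact: addr_ge0.
move=> s t sI tI; rewrite mulrDl (le_trans (ler_normD _ _))//.
by rewrite lerD// ?h1C ?h2C.
Qed.

Lemma continuous_bounded_itv (g : R -> R) : continuous g ->
  exists2 C : R, 0 <= C & {in `[-1, 1], forall s, `|g s| <= C}.
Proof.
move=> cg.
have h : {within `[-1, 1], continuous (fun s => `|g s|)}.
  apply: continuous_subspaceT => s; apply: continuous_comp; first exact: cg.
  exact: norm_continuous.
have N11 : (-1 : R) <= 1 by lra.
have [c cI cmax] := EVT_max N11 h.
by exists `|g c|.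
Qed.

Lemma dominatedMl (g : R -> R) h : continuous g -> dominated h ->
  dominated (fun s t => g s * h s t).
Proof.
move=> cg [mh [C C0 hC]]; split.
  apply: measurable_funM => //; apply: measurableT_comp => //.
  exact: continuous_measurable_fun.
have [K K0 gK] := continuous_bounded_itv _ cg.
exists (K * C); first exact: mulr_ge0.
by move=> s t sI tI; rewrite normrM -mulrA ler_pM// ?gK ?hC.
Qed.

Lemma dominatedMr (g : R -> R) h : continuous g -> dominated h ->
  dominated (fun s t => g t * h s t).
Proof.
move=> cg [mh [C C0 hC]]; split.
  apply: measurable_funM => //; apply: measurableT_comp => //.
  exact: continuous_measurable_fun.
have [K K0 gK] := continuous_bounded_itv _ cg.
exists (K * C); first exact: mulr_ge0.
by move=> s t sI tI; rewrite normrM -mulrA ler_pM// ?gK ?hC.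
Qed.

Lemma integrable_cst_itv (c : R) : mu.-integrable (`[-1, 1] : set R) (EFin \o cst c).
Proof.
apply: continuous_compact_integrable; first exact: segment_compact.
by apply: continuous_subspaceT => x; exact: cvg_cst.
Qed.

Lemma dominated_section1 h s : dominated h -> s \in `[-1, 1] ->
  mu.-integrable (`[-1, 1] : set R) (EFin \o h s).
Proof.
move=> [mh [C C0 hC]] sI.
have mhs : measurable_fun [set: measurableTypeR R] (h s).
  exact: (measurable_fun_pair2 (f := fun p => h p.1 p.2)).
apply: (@le_integrable _ _ _ mu _ _ _ (fun t => (C * (1 + phi s) + C * psi t)%:E)) => //.
- by apply/measurable_EFinP; apply: measurable_funS mhs.
- move=> t tI /=; rewrite lee_fin (le_trans (hC _ _ sI tI))//.
  by rewrite -mulrDr ler_norm.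
have i2 := @integrableZl _ _ _ mu _ _ C _ ipsi.
by apply: eq_integrable (integrableD _ (integrable_cst_itv (C * (1 + phi s))) (i2 _)).
Qed.

Lemma dominated_section2 h t : dominated h -> t \in `[-1, 1] ->
  mu.-integrable (`[-1, 1] : set R) (EFin \o h^~ t).
Proof.
move=> [mh [C C0 hC]] tI.
have mht : measurable_fun [set: measurableTypeR R] (h^~ t).
  exact: (measurable_fun_pair1 (f := fun p => h p.1 p.2)).
apply: (@le_integrable _ _ _ mu _ _ _ (fun s => (C * (1 + psi t) + C * phi s)%:E)) => //.
- by apply/measurable_EFinP; apply: measurable_funS mht.
- move=> s sI /=; rewrite lee_fin (le_trans (hC _ _ sI tI))//.
  by rewrite -mulrDr addrAC ler_norm.
have i2 := @integrableZl _ _ _ mu _ _ C _ iphi.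
by apply: eq_integrable (integrableD _ (integrable_cst_itv (C * (1 + psi t))) (i2 _)).
Qed.

Notation mu2 := (mu \x mu)%E.

Lemma mem_square (s t : R) : ((s, t) \in (square : set RR)) = (s \in `[-1, 1]) && (t \in `[-1, 1]).
Proof. by apply/idP/idP => [/set_mem[/= -> ->]//|/andP[sI tI]]; apply/mem_set; split. Qed.

Lemma integral_square_section1 (h : RR -> \bar R) (s : measurableTypeR R) :
  (\int[mu]_t (h \_ square) (s, t) =
   ((fun s => \int[mu]_(t in `[(-1)%R, 1%R]) h (s, t)) \_ `[(-1)%R, 1%R]) s)%E.
Proof.
rewrite patchE; case: ifPn => sI.
  rewrite [RHS]integral_mkcond; apply: eq_integral => t _; rewrite !patchE mem_square.
  by rewrite inE /= in sI; rewrite sI /= mem_setE.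
apply: integral0_eq => t _; rewrite patchE mem_square ifF//.
by apply/negbTE; apply: contra sI => /andP[sI _]; rewrite inE.
Qed.

Lemma integral_square_section2 (h : RR -> \bar R) (t : measurableTypeR R) :
  (\int[mu]_s (h \_ square) (s, t) =
   ((fun t => \int[mu]_(s in `[(-1)%R, 1%R]) h (s, t)) \_ `[(-1)%R, 1%R]) t)%E.
Proof.
rewrite patchE; case: ifPn => tI.
  rewrite [RHS]integral_mkcond; apply: eq_integral => s _; rewrite !patchE mem_square.
  by rewrite inE /= in tI; rewrite tI /= andbT mem_setE.
apply: integral0_eq => s _; rewrite patchE mem_square ifF//.
by apply/negbTE; apply: contra tI => /andP[_ tI]; rewrite inE.
Qed.

Lemma measurable_square : measurable (square : set RR).
Proof. by apply: measurableX; exact: measurable_itv. Qed.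

Lemma dominated_integrable h : dominated h ->
  mu2.-integrable (square : set RR) (fun p => (h p.1 p.2)%:E).
Proof.
move=> [mh [C C0 hC]].
have mI : measurable (`[-1, 1] : set (measurableTypeR R)) by exact: measurable_itv.
have mhsq : measurable_fun [set: RR] ((fun p : RR => (h p.1 p.2)%:E) \_ square).
  apply/(measurable_restrictT _ measurable_square)/measurable_EFinP.
  exact: measurable_funTS.
apply/(integrable_mkcond _ measurable_square)/integrable12ltyP => //.
pose K : R := \int[mu]_(t in `[-1, 1]) psi t.
pose g (s : R) : R := 2 * (C * (1 + phi s)) + C * K.
have ig : mu.-integrable (`[-1, 1] : set R) (EFin \o g).
  have i1 := integrable_cst_itv (2 * C + C * K).
  have i2 := @integrableZl _ _ _ mu _ mI (2 * C) _ iphi.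
  apply: eq_integrable (integrableD _ i1 i2) => // s _ /=.
  by rewrite -EFinM -EFinD; congr EFin; rewrite /g; ring.
move/(integrable_mkcond _ mI)/integrableP : ig => [mg]; apply: le_lt_trans.
apply: ge0_le_integral => //.
- by move=> s _; exact: integral_ge0.
- have mahsq := measurableT_comp (@abse_measurable R setT) mhsq.
  have mF := measurable_fun_fubini_tonelli_F (m2 := mu) _ mahsq (fun=> abse_ge0 _).
  exact: mF.
- exact: measurableT_comp.
move=> s _.
have -> : (\int[mu]_t `|((fun p : RR => (h p.1 p.2)%:E) \_ square) (s, t)| =
  \int[mu]_t ((fun p : RR => (`|h p.1 p.2|)%:E) \_ square) (s, t))%E.
  by apply: eq_integral => t _; rewrite !patchE; case: ifP => //=; rewrite normr0.
rewrite integral_square_section1 !patchE; case: ifPn => [|_]; last by rewrite abse0.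
rewrite inE /= => sI.
have mhs : measurable_fun [set: measurableTypeR R] (h s).
  exact: (measurable_fun_pair2 (f := fun p => h p.1 p.2)).
have i1 := integrable_cst_itv (C * (1 + phi s)).
have i2 := @integrableZl _ _ _ mu _ mI C _ ipsi.
apply: (@le_trans _ _
  (\int[mu]_(t in `[(-1)%R, 1%R]) ((C * (1 + phi s))%:E + C%:E * (psi t)%:E))%E).
  apply: ge0_le_integral => //.
  - by apply/measurable_EFinP; apply: measurable_funTS; exact: measurableT_comp.
  - exact: measurable_int (integrableD _ i1 i2).
  - move=> t tI; rewrite -EFinM -EFinD lee_fin (le_trans (hC _ _ sI tI))//.
    by rewrite -mulrDr.
rewrite integralD//= integralZl// integral_cst//= lebesgue_measure_itv /= lte_fin.
have N11 : (-1 : R) < 1 by lra.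
rewrite N11 -EFinB -EFinM.
have -> : (\int[mu]_(t in `[(-1)%R, 1%R]) (psi t)%:E)%E = K%:E.
  by rewrite /K /Rintegral fineK//; exact: integrable_fin_num.
rewrite -EFinM -EFinD lee_fin (le_trans _ (ler_norm _))// /g.
lra.
Qed.

Lemma dominated_Fubini1 h : dominated h ->
  \int[mu2]_(p in square) h p.1 p.2 =
  \int[mu]_(s in `[-1, 1]) \int[mu]_(t in `[-1, 1]) h s t.
Proof.
move=> dh; have ih := dominated_integrable _ dh.
have mI : measurable (`[-1, 1] : set (measurableTypeR R)) by exact: measurable_itv.
rewrite /Rintegral integral_mkcond -integral12_prod_meas1; last first.
  exact/(integrable_mkcond _ measurable_square).
congr fine; rewrite [RHS]integral_mkcond; apply: eq_integral => s _.
rewrite /fubini_F integral_square_section1 !patchE; case: ifPn => //; rewrite inE /= => sI.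
by rewrite fineK//; apply: integrable_fin_num => //; exact: dominated_section1.
Qed.

Lemma dominated_Fubini2 h : dominated h ->
  \int[mu2]_(p in square) h p.1 p.2 =
  \int[mu]_(t in `[-1, 1]) \int[mu]_(s in `[-1, 1]) h s t.
Proof.
move=> dh; have ih := dominated_integrable _ dh.
have mI : measurable (`[-1, 1] : set (measurableTypeR R)) by exact: measurable_itv.
rewrite /Rintegral integral_mkcond -integral21_prod_meas1; last first.
  exact/(integrable_mkcond _ measurable_square).
congr fine; rewrite [RHS]integral_mkcond; apply: eq_integral => t _.
rewrite /fubini_G integral_square_section2 !patchE; case: ifPn => //; rewrite inE /= => tI.
by rewrite fineK//; apply: integrable_fin_num => //; exact: dominated_section2.
Qed.

End Domination.

(** * Integration by parts on the square *)

Section Green.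
Context {R : realType}.
Notation mu := (@lebesgue_measure R).
Notation mu2 := (mu \x mu)%E.
Implicit Types (f g V : {poly R}).

Lemma is_derive_reflect (G : R -> R) (x s l : R) :
  is_derive (x - s) 1 G l -> is_derive s 1 (fun s => G (x - s)) (- l).
Proof.
move=> D.
have D1 : is_derive s 1 (fun s : R => x - s) (-1).
  have D0 := is_deriveB (is_derive_cst x s (1 : R)) (is_derive_id s (1 : R)).
  by apply: (is_derive_eq D0); rewrite sub0r.
have D2 := @is_derive1_comp R G (fun s => x - s) s _ _ D D1.
by apply: (is_derive_eq D2); rewrite mulrN1.
Qed.

Lemma continuous_reflect (G : R -> R) (x s : R) :
  {for x - s, continuous G} -> {for s, continuous (fun s => G (x - s))}.
Proof.
move=> cG; have h : x - u @[u --> s] --> x - s.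
  by apply: cvgB; [exact: cvg_cst|exact: cvg_id].
by have := cvg_comp _ _ h cG; exact.
Qed.

(** The product [f(s) G(x - s)] is continuous, and its derivative is the integrand
    except at [s = x]. *)
Lemma by_parts_reflect (G G' : R -> R) (x : R) f : continuous G ->
  (forall u : R, u != 0 -> is_derive u 1 G (G' u)) ->
  (forall u : R, u != 0 -> {for u, continuous G'}) ->
  mu.-integrable (`[-1, 1] : set R)
    (EFin \o (fun s => f^`().[s] * G (x - s) - f.[s] * G' (x - s))) ->
  \int[mu]_(s in `[-1, 1]) (f^`().[s] * G (x - s) - f.[s] * G' (x - s)) =
  f.[1] * G (x - 1) - f.[-1] * G (x + 1).
Proof.
move=> cG dG cG' ih.
have nz (s : R) : s != x -> x - s != 0 by rewrite subr_eq0 eq_sym.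
have N11 : (-1 : R) <= 1 by lra.
rewrite (FTC_but_one (fun s => f.[s] * G (x - s)) _ _ _ x N11 _ _ _ ih) ?opprK//.
- move=> s; apply: (@cvgM _ _ (nbhs s)); first exact: continuous_horner.
  by apply: continuous_reflect; exact: cG.
- move=> s /nz sx.
  have D := is_deriveM (is_derive_poly f s) (is_derive_reflect _ _ _ _ (dG _ sx)).
  by apply: (is_derive_eq D); rewrite /GRing.scale /=; ring.
- move=> s /nz sx; apply: (@cvgB _ _ _ (nbhs s)).
    apply: (@cvgM _ _ (nbhs s)); first exact: continuous_horner.
    by apply: continuous_reflect; exact: cG.
  apply: (@cvgM _ _ (nbhs s)); first exact: continuous_horner.
  by apply: continuous_reflect; exact: cG'.
Qed.

Definition heaviside (x s : R) : R := if x < s then 1 else 0.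

Lemma integrable_poly_heaviside f x :
  mu.-integrable (`[-1, 1] : set R) (EFin \o (fun s => f.[s] * heaviside x s)).
Proof.
have ip : mu.-integrable (`[-1, 1] : set R) (EFin \o (fun s => f.[s])).
  apply: continuous_compact_integrable; first exact: segment_compact.
  by apply: continuous_subspaceT; exact: continuous_horner.
have mf : measurable_fun [set: measurableTypeR R] (fun s => f.[s]).
  by apply: continuous_measurable_fun; exact: continuous_horner.
have mH : measurable_fun [set: measurableTypeR R] (heaviside x).
  apply: measurable_fun_ifT => //.
  by apply: measurable_fun_ltr.
apply: le_integrable ip => //.
- by apply/measurable_EFinP; apply: measurable_funTS; exact: measurable_funM.
- move=> s _ /=; rewrite lee_fin normrM /heaviside; case: ifP => _.
    by rewrite normr1 mulr1.
  by rewrite normr0 mulr0.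
Qed.

(** [V (max s x)] is a continuous primitive of the integrand, with a kink at [x]. *)
Lemma integral_heaviside V x :
  \int[mu]_(s in `[-1, 1]) (V^`().[s] * heaviside x s) =
  V.[Num.max 1 x] - V.[Num.max (-1) x].
Proof.
have N11 : (-1 : R) <= 1 by lra.
have near_lt (s : R) : s != x -> \forall u \near s, (x < u) = (x < s).
  move=> sx; have [sx0|xs|sx0] := ltgtP x s; last by rewrite sx0 eqxx in sx.
  - by near=> u; near: u; exact: lt_nbhsr.
  - by near=> u; apply/negbTE; rewrite -leNgt ltW//; near: u; exact: lt_nbhsl.
apply: (FTC_but_one (fun s => V.[Num.max s x]) _ _ _ x N11 _ _ _ (integrable_poly_heaviside _ _)).
- move=> s.
  have h : Num.max u x @[u --> s] --> Num.max s x.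
    by apply: continuous_max; [exact: cvg_id|exact: cvg_cst].
  by have := cvg_comp _ _ h (@continuous_horner R V (Num.max s x)); exact.
- move=> s sx.
  have nl := near_lt _ sx.
  rewrite /heaviside; case: ifPn => xs.
    rewrite mulr1; apply: near_eq_is_derive (is_derive_poly V s).
    near=> u; have : x < u by have -> : (x < u) = (x < s) by near: u.
    by move=> xu; rewrite max_l// ltW.
  rewrite mulr0; apply: near_eq_is_derive (is_derive_cst V.[x] s 1).
  near=> u; have : ~~ (x < u) by have -> : (x < u) = (x < s) by near: u.
  by rewrite -leNgt => xu; rewrite max_r.
- move=> s sx; have nl := near_lt _ sx.
  have ch : heaviside x u @[u --> s] --> heaviside x s.
    have nh : \forall u \near s, heaviside x s = heaviside x u.
      by near=> u; rewrite /heaviside; have -> : (x < u) = (x < s) by near: u.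
    exact: (cvg_trans (near_eq_cvg nh) (cvg_cst (heaviside x s))).
  by apply: (@cvgM _ _ (nbhs s)); first exact: continuous_horner.
Unshelve. all: by end_near. Qed.

Lemma integrable_poly f :
  mu.-integrable (`[-1, 1] : set R) (EFin \o (fun s => f.[s])).
Proof.
apply: continuous_compact_integrable; first exact: segment_compact.
by apply: continuous_subspaceT; exact: continuous_horner.
Qed.

Section Square.
Variables phi psi : R -> R.
Hypothesis iphi : mu.-integrable (`[-1, 1] : set R) (EFin \o phi).
Hypothesis ipsi : mu.-integrable (`[-1, 1] : set R) (EFin \o psi).
Notation dom := (dominated phi psi).

Lemma dom_poly1 f h : dom h -> dom (fun s t => f.[s] * h s t).
Proof. by apply: dominatedMl => //; exact: continuous_horner. Qed.

Lemma dom_poly2 f h : dom h -> dom (fun s t => f.[t] * h s t).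
Proof. by apply: dominatedMr => //; exact: continuous_horner. Qed.

Lemma domN h : dom h -> dom (fun s t => - h s t).
Proof.
move=> /(dom_poly1 (- 1)%:P); congr dominated; apply/funext => s; apply/funext => t.
by rewrite hornerC mulN1r.
Qed.

Lemma domB h1 h2 : dom h1 -> dom h2 -> dom (fun s t => h1 s t - h2 s t).
Proof. by move=> d1 d2; apply: dominatedD => //; exact: domN. Qed.

(** The second integration by parts, along an edge of the square. *)
Lemma edge_integral (h p : R -> R) (J : R) :
  mu.-integrable (`[-1, 1] : set R) (EFin \o h) ->
  mu.-integrable (`[-1, 1] : set R) (EFin \o p) ->
  \int[mu]_(s in `[-1, 1]) (h s - p s) = J ->
  \int[mu]_(s in `[-1, 1]) h s = J + \int[mu]_(s in `[-1, 1]) p s.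
Proof.
by move=> ih ip <-; rewrite RintegralB// subrK.
Qed.

(** [- P] and [- Q] play the role of the partial derivatives of [H] in [s] and in [t],
    and [E s] is the error of the integration by parts in [t] when [H] jumps on the line
    through [s]. The double integrand is [f' d/dt (g H) - g' d/ds (f H)], whose two terms
    are integrated in opposite orders. The values of [H] at the corners appear twice and cancel. *)
Lemma Green_square (H P Q : R -> R -> R) (E : R -> R) f g :
  dom H -> dom P -> dom Q ->
  mu.-integrable (`[-1, 1] : set R) (EFin \o (fun s => f^`().[s] * E s)) ->
  (forall t, t \in `[-1, 1] ->
    \int[mu]_(s in `[-1, 1]) (f^`().[s] * H s t - f.[s] * P s t) =
    f.[1] * H 1 t - f.[-1] * H (-1) t) ->
  (forall s, s \in `[-1, 1] ->
    \int[mu]_(t in `[-1, 1]) (g^`().[t] * H s t - g.[t] * Q s t) =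
    g.[1] * H s 1 - g.[-1] * H s (-1) + E s) ->
  \int[mu2]_(p in square) (f.[p.1] * g^`().[p.2] * P p.1 p.2
                          - f^`().[p.1] * g.[p.2] * Q p.1 p.2) =
  g.[1] * \int[mu]_(s in `[-1, 1]) (f.[s] * P s 1)
  - g.[-1] * \int[mu]_(s in `[-1, 1]) (f.[s] * P s (-1))
  - f.[1] * \int[mu]_(t in `[-1, 1]) (g.[t] * Q 1 t)
  + f.[-1] * \int[mu]_(t in `[-1, 1]) (g.[t] * Q (-1) t)
  + (\int[mu]_(s in `[-1, 1]) (f^`().[s] * E s) - f.[1] * E 1 + f.[-1] * E (-1)).
Proof.
move=> dH dP dQ iE hS hT.
have mI : measurable (`[-1, 1] : set (measurableTypeR R)) by exact: measurable_itv.
have I1 : (1 : R) \in `[-1, 1] by rewrite in_itv /= lexx andbT; lra.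
have IN1 : (-1 : R) \in `[-1, 1] by rewrite in_itv /= lexx /=; lra.
(* [U] integrates explicitly in [t], and [V] in [s]. *)
pose U s t := f^`().[s] * (g^`().[t] * H s t - g.[t] * Q s t).
pose V s t := g^`().[t] * (f^`().[s] * H s t - f.[s] * P s t).
have dU : dom U by apply: dom_poly1; apply: domB; exact: dom_poly2.
have dV : dom V by apply: dom_poly2; apply: domB; exact: dom_poly1.
have sec1 h t : dom h -> t \in `[-1, 1] -> mu.-integrable (`[-1, 1] : set R) (EFin \o h^~ t).
  by move=> dh tI; apply: (dominated_section2 phi psi).
have sec2 h s : dom h -> s \in `[-1, 1] -> mu.-integrable (`[-1, 1] : set R) (EFin \o h s).
  by move=> dh tI; apply: (dominated_section1 phi psi).
transitivity (\int[mu2]_(p in square) (U p.1 p.2 - V p.1 p.2)).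
  by apply: eq_Rintegral => -[s t] _ /=; rewrite /U /V; ring.
rewrite RintegralB;
  [|exact: measurable_square|exact: (dominated_integrable phi psi)..].
rewrite (dominated_Fubini1 phi psi)// (dominated_Fubini2 phi psi)//.
have -> : \int[mu]_(s in `[-1, 1]) \int[mu]_(t in `[-1, 1]) U s t =
   \int[mu]_(s in `[-1, 1])
     (g.[1] * (f^`().[s] * H s 1) - g.[-1] * (f^`().[s] * H s (-1)) + f^`().[s] * E s).
  apply: eq_Rintegral => s; rewrite inE /= => sI.
  rewrite /U RintegralZl//; first by rewrite hT//; ring.
  apply: (sec2 (fun s t => g^`().[t] * H s t - g.[t] * Q s t)) => //.
  by apply: domB; exact: dom_poly2.
have -> : \int[mu]_(t in `[-1, 1]) \int[mu]_(s in `[-1, 1]) V s t =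
   \int[mu]_(t in `[-1, 1]) (f.[1] * (g^`().[t] * H 1 t) - f.[-1] * (g^`().[t] * H (-1) t)).
  apply: eq_Rintegral => t; rewrite inE /= => tI.
  rewrite /V RintegralZl//; first by rewrite hS//; ring.
  apply: (sec1 (fun s t => f^`().[s] * H s t - f.[s] * P s t)) => //.
  by apply: domB; exact: dom_poly1.
have iZ c (h : R -> R) : mu.-integrable (`[-1, 1] : set R) (EFin \o h) ->
   mu.-integrable (`[-1, 1] : set R) (EFin \o (fun s => c * h s)).
  move=> ih; apply: eq_integrable (integrableZl mI c ih) => //.
have iB (h1 h2 : R -> R) : mu.-integrable (`[-1, 1] : set R) (EFin \o h1) ->
   mu.-integrable (`[-1, 1] : set R) (EFin \o h2) ->
   mu.-integrable (`[-1, 1] : set R) (EFin \o (fun s => h1 s - h2 s)).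
  move=> i1 i2; apply: eq_integrable (integrableB mI i1 i2) => //.
have fH t : t \in `[-1, 1] ->
    mu.-integrable (`[-1, 1] : set R) (EFin \o (fun s => f^`().[s] * H s t)).
  by move=> tI; apply: (sec1 (fun s t => f^`().[s] * H s t)) => //; exact: dom_poly1.
have fP t : t \in `[-1, 1] -> mu.-integrable (`[-1, 1] : set R) (EFin \o (fun s => f.[s] * P s t)).
  by move=> tI; apply: (sec1 (fun s t => f.[s] * P s t)) => //; exact: dom_poly1.
have gH s : s \in `[-1, 1] ->
    mu.-integrable (`[-1, 1] : set R) (EFin \o (fun t => g^`().[t] * H s t)).
  by move=> tI; apply: (sec2 (fun s t => g^`().[t] * H s t)) => //; exact: dom_poly2.
have gQ s : s \in `[-1, 1] -> mu.-integrable (`[-1, 1] : set R) (EFin \o (fun t => g.[t] * Q s t)).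
  by move=> tI; apply: (sec2 (fun s t => g.[t] * Q s t)) => //; exact: dom_poly2.
rewrite RintegralD//; last by apply: iB; apply: iZ; exact: fH.
rewrite RintegralB//; [|by apply: iZ; exact: fH..].
rewrite RintegralB//; [|by apply: iZ; exact: gH..].
rewrite !RintegralZl//; [|by [exact: fH|exact: gH]..].
rewrite (edge_integral _ _ _ (fH _ I1) (fP _ I1) (hS _ I1)).
rewrite (edge_integral _ _ _ (fH _ IN1) (fP _ IN1) (hS _ IN1)).
rewrite (edge_integral _ _ _ (gH _ I1) (gQ _ I1) (hT _ I1)).
rewrite (edge_integral _ _ _ (gH _ IN1) (gQ _ IN1) (hT _ IN1)).
ring.
Qed.

End Square.
End Green.

(** * The matrix C and the rank of the right-hand side *)

Section Matrices.
Context {R : realType}.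
Implicit Types (k j : nat) (z : R[i]).

Lemma odd_natr_neq0 (K : numFieldType) k : 2 * k%:R + 1 != 0 :> K.
Proof. by rewrite -natrM natr1 pnatr_eq0. Qed.

Lemma mxCE (K : numFieldType) k j : mxC K k j =
  if j == k.+1 then 1 / (2 * k%:R + 1)
  else if k == j.+1 then - (1 / (2 * k%:R + 1)) else 0.
Proof.
have k0 := odd_natr_neq0 K k.
rewrite /mxC /mxA /mxB; have [kj|kj] := eqVneq k j.+1.
  rewrite {}kj in k0 *.
  rewrite (_ : (j == j.+2) = false); last by apply/negbTE; lia.
  by move: (j.+1%:R) k0 => x k0; field.
by have [_|_] := eqVneq j k.+1; [field|rewrite subrr].
Qed.

Lemma mxC_mul (K : numFieldType) (G : nat -> K) k :
  \sum_(l \in [set: nat]) (mxC K k l * G l) =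
  (G k.+1 - (if k is k'.+1 then G k' else 0)) / (2 * k%:R + 1).
Proof.
have k0 := odd_natr_neq0 K k.
case: k k0 => [|k] k0.
  rewrite (fsbigE [:: 1%N])//=.
    by rewrite big_cons big_nil /= mem_set// mxCE /= addr0; field.
  move=> i _; rewrite inE => i1; rewrite mxCE /= (negbTE i1).
  by rewrite mul0r.
rewrite (fsbigE [:: k.+2; k])//=.
- rewrite !big_cons big_nil /= !mem_set//= addr0 !mxCE eqxx.
  rewrite (_ : (k == k.+2) = false); last by apply/negbTE; lia.
  by rewrite eqxx; field.
- by rewrite inE andbT; lia.
- move=> i _; rewrite !inE negb_or => /andP[i1 i2]; rewrite mxCE (negbTE i1).
  by rewrite eqSS eq_sym (negbTE i2) mul0r.
Qed.

(** The three generators are the column [0], the common column [b], and the first unit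
    vector, which carries row [0]. *)
Lemma rank_cross (b u : nat -> R[i]) (c r : nat -> R[i]) :
  infmx_rank_le 3 (fun k j =>
    if j is 0 then u k else c j * b k + (if k is 0 then r j else 0)).
Proof.
exists (fun i => match val i with
  0 => u | 1 => b | _ => (fun k => if k is 0 then 1 else 0) end).
case=> [|j].
  exists (fun i => if val i is 0 then 1 else 0) => k.
  by rewrite !big_ord_recl big_ord0 /= !mul0r !addr0 mul1r.
exists (fun i => match val i with 0 => 0 | 1 => c j.+1 | _ => r j.+1 end) => k.
rewrite !big_ord_recl big_ord0 /= mul0r add0r addr0; congr (_ + _).
by case: k => [|k]; rewrite ?mulr1 ?mulr0.
Qed.

Lemma rank_F_of (bz : nat -> R[i] -> R) z :
  infmx_rank_le 3 (fun k j => F2_of bz z k j - F1 z k j).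
Proof.
have [u hu] := rank_cross (fun k => (bz k z)%:C) (fun k => F2_of bz z k 0 - F1 z k 0)
  (fun j => 2 * 'i%C * (pi * ultra_m12 j.+1 (complex.Im z))%:C)
  (fun j => (if j == 1%N then - (4 * 'i%C / 3) else 0) - F1 z 0 j).
exists u => j; have [a ha] := hu j; exists a => k; rewrite -ha.
case: j {a ha} => [//|j].
have e : beta_of bz k j.+1 z =
    2 * 'i%C * (pi * ultra_m12 j.+2 (complex.Im z))%:C * (bz k z)%:C.
  by rewrite /beta_of !rmorphM /= !mulrA.
rewrite -e; case: k {e} => [|[|k]]; case: j => [|j] //=; rewrite ?subr0 ?addr0 ?sub0r//; ring.
Qed.

Lemma b_square1 k : b_square k (1 : R) = 0.
Proof. by rewrite b_squareE legendre_primitive2_1 subrr mulr0 addr0. Qed.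

(** Off the edges the two regions of definition differ only at [z = 1 + i], where
    [b_square] vanishes. *)
Lemma b_corrE k z : ~~ edge z -> b k z = b_corr k z.
Proof.
case: z => x y; rewrite /edge /b /b_corr /=.
case: (ltgtP y 1) => y1; case: (ltgtP y (-1)) => y2;
  case: (ltgtP x 1) => x1; case: (ltgtP x (-1)) => x2 //=; try lra.
by rewrite x1 b_square1.
Qed.

Lemma F_corrE z : ~~ edge z -> F z = F_corr z.
Proof.
move=> ez; have be k j : beta_of b k j z = beta_of b_corr k j z.
  by rewrite /beta_of b_corrE.
apply/funext => k; apply/funext => j; rewrite /F /F_corr; congr (_ - _).
by case: k => [|k]; case: j => [|[|j]] /=; rewrite be.
Qed.

End Matrices.

(** * Green's identity for the logarithm *)

Section LogGreen.
Context {R : realType}.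
Notation mu := (@lebesgue_measure R).
Notation mu2 := (mu \x mu)%E.
Notation RR := (measurableTypeR R * measurableTypeR R)%type.
Implicit Types (f g V : {poly R}) (x y : R).

Lemma lnr0_le (K u : R) : `|u| <= K -> lnr u 0 <= K ^+ 2.
Proof.
move=> uK; have u2 : u ^+ 2 <= K ^+ 2.
  by rewrite -real_normK ?num_real// ler_sqr ?nnegrE// (le_trans _ uK).
rewrite lnrE expr0n /= addr0; have [->|u0] := eqVneq u 0.
  by rewrite expr0n ln0// mul0r sqr_ge0.
have p : 0 < u ^+ 2 by rewrite exprn_even_gt0.
by have := ln_sublinear p; lra.
Qed.

Lemma norm_itv_le x s : s \in `[-1, 1] -> `|x - s| <= `|x| + 1.
Proof.
rewrite in_itv /= => sI; rewrite (le_trans (ler_normB _ _))// lerD2l ler_norml//.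
Qed.

(** [ln |x - s|] is bounded above on the interval and has the continuous primitive
    [- potRe (x - s) 0], hence the nonnegative function [K - ln |x - s|] is integrable. *)
Lemma integrable_lnr x :
  mu.-integrable (`[-1, 1] : set R) (EFin \o (fun s => lnr (x - s) 0)).
Proof.
have mI : measurable (`[-1, 1] : set (measurableTypeR R)) by exact: measurable_itv.
have N11 : (-1 : R) <= 1 by lra.
(* A bound of [ln |x - s|] for [s] in the interval, by [ln v <= v]. *)
pose K : R := (`|x| + 1) ^+ 2.
pose h s : R := K - lnr (x - s) 0.
have nz (s : R) : s != x -> x - s != 0 by rewrite subr_eq0 eq_sym.
have mlnr : measurable_fun [set: measurableTypeR R] (fun s : measurableTypeR R => lnr (x - s) 0).
  under eq_fun do rewrite lnrE expr0n /= addr0.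
  apply: measurable_funM => //; apply: (measurableT_comp (@measurable_ln R)).
  by apply: measurable_funX; exact: measurable_funB.
have ih : mu.-integrable (`[-1, 1] : set R) (EFin \o h).
  apply: (ge0_integrable_but_one (fun s => K * s + potRe (x - s) 0) h _ _ x N11).
  - move=> s; apply: (@cvgD _ _ _ (nbhs s)).
      by apply: (@cvgM _ _ (nbhs s)); [exact: cvg_cst|exact: cvg_id].
    by apply: (continuous_reflect (fun u => potRe u 0)); exact: continuous_potRe_x.
  - move=> s /nz sx.
    have D1 := is_deriveZ K (is_derive_id s (1 : R)).
    have D2 := is_derive_reflect _ _ _ _ (is_derive_potRe_x _ 0 sx).
    have D := is_deriveD D1 D2.
    by apply: (is_derive_eq D); rewrite /GRing.scale /= mulr1.
  - move=> s /nz sx; apply: (@cvgB _ _ _ (nbhs s)); first exact: cvg_cst.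
    by apply: (continuous_reflect (fun u => lnr u 0)); apply: continuous_lnr_x; rewrite sx.
  - by apply: measurable_funB.
  - by move=> s sI; rewrite subr_ge0 lnr0_le// norm_itv_le.
apply: eq_integrable (integrableB mI (integrable_poly K%:P) ih) => // s _ /=.
by rewrite hornerC -EFinB /h subKr.
Qed.

Variables x y : R.
Let phi s : R := `|lnr (x - s) 0|.
Let psi t : R := `|lnr 0 (y - t)|.
Notation dom := (dominated phi psi).

Let iphi : mu.-integrable (`[-1, 1] : set R) (EFin \o phi).
Proof. exact: (integrable_norm (integrable_lnr x)). Qed.

Let ipsi : mu.-integrable (`[-1, 1] : set R) (EFin \o psi).
Proof.
rewrite (_ : psi = (fun t => `|lnr (y - t) 0|)).
  exact: (integrable_norm (integrable_lnr y)).
by apply/funext => t; rewrite /psi lnrC.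
Qed.

Let mx : measurable_fun [set: RR] (fun p : RR => x - p.1).
Proof. by apply: measurable_funB => //; exact: measurable_fst. Qed.

Let my : measurable_fun [set: RR] (fun p : RR => y - p.2).
Proof. by apply: measurable_funB => //; exact: measurable_snd. Qed.

Lemma dom_lnr : dom (fun s t => lnr (x - s) (y - t)).
Proof.
split; first exact: measurable_lnr.
exists ((`|x| + `|y| + 1) ^+ 2 + 1); first by rewrite addr_ge0// sqr_ge0.
move=> s t sI tI.
have bx : `|x - s| <= `|x| + `|y| + 1.
  by rewrite (le_trans (norm_itv_le x _ sI))// addrAC lerDl.
have by_ : `|y - t| <= `|x| + `|y| + 1.
  by rewrite (le_trans (norm_itv_le y _ tI))// -addrA lerDr.
rewrite (le_trans (lnr_bound _ _ _ bx by_))// -/(phi s) -/(psi t).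
have p0 : 0 <= phi s by rewrite normr_ge0.
have q0 : 0 <= psi t by rewrite normr_ge0.
have K0 : 0 <= (`|x| + `|y| + 1) ^+ 2 by rewrite sqr_ge0.
by move: K0; set K := (_ + _) ^+ 2; nra.
Qed.

Lemma dom_arg : dom (fun s t => arg (x - s) (y - t)).
Proof.
split; first exact: measurable_arg.
exists pi; first exact: pi_ge0.
move=> s t _ _; rewrite (le_trans (arg_bound _ _))// ler_peMr ?pi_ge0//.
by rewrite -addrA lerDl addr_ge0 ?normr_ge0.
Qed.

Lemma dom_poly_x f : dom (fun s t => f.[s]).
Proof.
have d1 : dom (fun s t => 1).
  split; first exact: measurable_cst.
  exists 1; first exact: ler01.
  by move=> s t _ _; rewrite normr1 mul1r -addrA lerDl addr_ge0 ?normr_ge0.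
have := dom_poly1 _ _ f _ d1; congr dominated.
by apply/funext => s; apply/funext => t; rewrite mulr1.
Qed.

Lemma dom_poly_y f : dom (fun s t => f.[t]).
Proof.
have := dom_poly2 _ _ f _ (dom_poly_x 1); congr dominated.
by apply/funext => s; apply/funext => t; rewrite -polyC1 hornerC mulr1.
Qed.

Lemma dom_potRe : dom (fun s t => potRe (x - s) (y - t)).
Proof.
have d1 := dom_poly1 _ _ (x%:P - 'X) _ dom_lnr.
have d2 := dom_poly2 _ _ (y%:P - 'X) _ dom_arg.
have := domB _ _ _ _ (domB _ _ _ _ d1 d2) (dom_poly_x (x%:P - 'X)).
congr dominated; apply/funext => s; apply/funext => t.
by rewrite !(hornerD, hornerN, hornerC, hornerX).
Qed.

Lemma dom_potIm : dom (fun s t => potIm (x - s) (y - t)).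
Proof.
have d1 := dom_poly1 _ _ (x%:P - 'X) _ dom_arg.
have d2 := dom_poly2 _ _ (y%:P - 'X) _ dom_lnr.
have := domB _ _ _ _ (dominatedD _ _ _ _ d1 d2) (dom_poly_y (y%:P - 'X)).
congr dominated; apply/funext => s; apply/funext => t.
by rewrite !(hornerD, hornerN, hornerC, hornerX).
Qed.

Lemma integrable_square_poly (h : R -> R -> R) f g : dom h ->
  mu2.-integrable (square : set RR) (EFin \o (fun u : RR => f.[u.1] * g.[u.2] * h u.1 u.2)).
Proof.
move=> dh; apply: eq_integrable (dominated_integrable phi psi iphi ipsi _
  (dom_poly1 _ _ f _ (dom_poly2 _ _ g _ dh))) => //; first exact: measurable_square.
by move=> u _ /=; rewrite mulrA.
Qed.

Lemma integrable_square_lnr f g : mu2.-integrable (square : set RR)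
  (EFin \o (fun u : RR => f.[u.1] * g.[u.2] * lnr (x - u.1) (y - u.2))).
Proof. exact: (integrable_square_poly _ _ _ dom_lnr). Qed.

Lemma integrable_square_arg f g : mu2.-integrable (square : set RR)
  (EFin \o (fun u : RR => f.[u.1] * g.[u.2] * arg (x - u.1) (y - u.2))).
Proof. exact: (integrable_square_poly _ _ _ dom_arg). Qed.

Let I0 : (0 : R) \in `[-1, 1].
Proof. by rewrite in_itv /=; apply/andP; split; lra. Qed.

Lemma integrable_hside f :
  mu.-integrable (`[-1, 1] : set R) (EFin \o (fun s => f.[s] * lnr (x - s) y)) /\
  mu.-integrable (`[-1, 1] : set R) (EFin \o (fun s => f.[s] * arg (x - s) y)).
Proof.
(* The horizontal segment is the section [t = 0] of the square. *)
split; rewrite -[y]subr0.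
  exact: (dominated_section2 _ _ iphi (fun s t => f.[s] * lnr (x - s) (y - t)) _
    (dom_poly1 _ _ f _ dom_lnr) I0).
exact: (dominated_section2 _ _ iphi (fun s t => f.[s] * arg (x - s) (y - t)) _
    (dom_poly1 _ _ f _ dom_arg) I0).
Qed.

Lemma integrable_vside f :
  mu.-integrable (`[-1, 1] : set R) (EFin \o (fun t => f.[t] * lnr x (y - t))) /\
  mu.-integrable (`[-1, 1] : set R) (EFin \o (fun t => f.[t] * arg x (y - t))).
Proof.
split; rewrite -[x]subr0.
  exact: (dominated_section1 _ _ ipsi (fun s t => f.[t] * lnr (x - s) (y - t)) _
    (dom_poly2 _ _ f _ dom_lnr) I0).
exact: (dominated_section1 _ _ ipsi (fun s t => f.[t] * arg (x - s) (y - t)) _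
    (dom_poly2 _ _ f _ dom_arg) I0).
Qed.

(** The value of [potIm u v] at [v = 0] minus its limit from below. *)
Definition cut_drop (u : R) : R := if u < 0 then 2 * pi * u else 0.

(** The points [s + i t] with [z - (s + i t)] on the cut form the half-line [t = y],
    [s > x], and [arg] is continuous at the cut from the side of [t < y]. If [y = 1] the
    whole square lies on that side. If [y = - 1] it lies on the other side, with the
    wrong one-sided value on its bottom edge, which counts as a jump. *)
Definition edge_value g y' : R := if -1 <= y' < 1 then g.[y'] else 0.

Lemma edge_valueE g y' : edge_value g y' =
  g.[1] * (y' - 1 < 0)%R%:R - g.[-1] * (y' + 1 < 0)%R%:R
  - (g.[Num.max 1 y'] - g.[Num.max (-1) y']).
Proof.
rewrite /edge_value subr_lt0 -[X in y' + X]opprK subr_lt0.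
have [y1|y1] := leP 1 y'.
  have yN : -1 <= y' by lra.
  by rewrite andbF max_r// [y' < -1]ltNge yN /= ?mulr0n; ring.
by have [yN|yN] := leP (-1) y'; rewrite /= ?mulr0n ?mulr1n; ring.
Qed.

Lemma potIm_aboveE u v : potIm_above u v = potIm u v + cut_drop u * (v < 0)%R%:R.
Proof.
by rewrite /potIm_above /cut_drop; case: (u < 0); case: (v < 0); rewrite /= ?mulr1 ?mulr0 ?mul0r.
Qed.

(** The real part of [w log w - w] is continuous across the cut, where the jump of
    [arg] is multiplied by [y = 0]. *)
Lemma Green_Re f g :
  \int[mu2]_(p in square) (f.[p.1] * g^`().[p.2] * lnr (x - p.1) (y - p.2)
                          + f^`().[p.1] * g.[p.2] * arg (x - p.1) (y - p.2)) =
  g.[1] * \int[mu]_(s in `[-1, 1]) (f.[s] * lnr (x - s) (y - 1))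
  - g.[-1] * \int[mu]_(s in `[-1, 1]) (f.[s] * lnr (x - s) (y + 1))
  + f.[1] * \int[mu]_(t in `[-1, 1]) (g.[t] * arg (x - 1) (y - t))
  - f.[-1] * \int[mu]_(t in `[-1, 1]) (g.[t] * arg (x + 1) (y - t)).
Proof.
have mI : measurable (`[-1, 1] : set (measurableTypeR R)) by exact: measurable_itv.
have I1 : (1 : R) \in `[-1, 1] by rewrite in_itv /= lexx andbT; lra.
have IN1 : (-1 : R) \in `[-1, 1] by rewrite in_itv /= lexx /=; lra.
have dargN := domN _ _ _ dom_arg.
have hS (t : R) : t \in `[-1, 1] ->
    \int[mu]_(s in `[-1, 1])
       (f^`().[s] * potRe (x - s) (y - t) - f.[s] * lnr (x - s) (y - t)) =
    f.[1] * potRe (x - 1) (y - t) - f.[-1] * potRe (x - -1) (y - t).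
  move=> tI; rewrite opprK.
  apply: (by_parts_reflect (fun u => potRe u (y - t)) (fun u => lnr u (y - t))).
  - exact: continuous_potRe_x.
  - by move=> u u0; exact: is_derive_potRe_x.
  - by move=> u u0; apply: continuous_lnr_x; rewrite u0.
  - apply: (dominated_section2 phi psi iphi
      (fun s t => f^`().[s] * potRe (x - s) (y - t) - f.[s] * lnr (x - s) (y - t))) => //.
    by apply: domB; apply: dom_poly1; [exact: dom_potRe|exact: dom_lnr].
have hT (s : R) : s \in `[-1, 1] ->
    \int[mu]_(t in `[-1, 1])
       (g^`().[t] * potRe (x - s) (y - t) - g.[t] * - arg (x - s) (y - t)) =
    g.[1] * potRe (x - s) (y - 1) - g.[-1] * potRe (x - s) (y - -1) + 0.
  move=> sI; rewrite opprK addr0.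
  apply: (by_parts_reflect (fun u => potRe (x - s) u) (fun u => - arg (x - s) u)).
  - exact: continuous_potRe_y.
  - by move=> u u0; exact: is_derive_potRe_y.
  - move=> u u0; apply: (@cvgN _ _ _ (nbhs u)).
    exact: (is_derive_continuous _ _ _ (is_derive_arg_y (x - s) u u0)).
  - apply: (dominated_section1 phi psi ipsi
      (fun s t => g^`().[t] * potRe (x - s) (y - t) - g.[t] * - arg (x - s) (y - t))) => //.
    by apply: domB; apply: dom_poly2; [exact: dom_potRe|exact: dargN].
have i0 : mu.-integrable (`[-1, 1] : set R) (EFin \o (fun s => f^`().[s] * 0)).
  by under [X in EFin \o X]eq_fun do rewrite mulr0; exact: integrable_cst_itv.
have := Green_square phi psi iphi ipsi (fun s t => potRe (x - s) (y - t))
  (fun s t => lnr (x - s) (y - t)) (fun s t => - arg (x - s) (y - t)) (fun=> 0) f g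
  dom_potRe dom_lnr dargN i0 hS hT.
have argN_int (u : R) : u \in `[-1, 1] ->
    \int[mu]_(t in `[-1, 1]) (g.[t] * - arg (x - u) (y - t)) =
    - \int[mu]_(t in `[-1, 1]) (g.[t] * arg (x - u) (y - t)).
  move=> uI; rewrite -[RHS]mulN1r -RintegralZl//; last first.
    apply: (dominated_section1 phi psi ipsi (fun s t => g.[t] * arg (x - s) (y - t))) => //.
    by apply: dom_poly2; exact: dom_arg.
  by apply: eq_Rintegral => t _; rewrite mulrN mulN1r.
rewrite (argN_int _ I1) (argN_int _ IN1) !opprK => e.
transitivity (\int[mu2]_(p in square)
      (f.[p.1] * g^`().[p.2] * lnr (x - p.1) (y - p.2) -
       f^`().[p.1] * g.[p.2] * - arg (x - p.1) (y - p.2))).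
  by apply: eq_Rintegral => p _; rewrite mulrN opprK.
rewrite e; under [X in _ + (X - _ + _)]eq_Rintegral do rewrite mulr0.
rewrite Rintegral_cst// mul0r; ring.
Qed.

(** The imaginary part [potIm] jumps on the cut. Each integration in [t] uses its
    continuous continuation [potIm_above] instead and pays the difference as the error
    term [E]. The function [cut_drop] in that error has a kink only, and integrating by
    parts once more against [f'] produces the primitive [V] of [f]. *)
Lemma Green_Im f g V : V^`() = f ->
  \int[mu2]_(p in square) (f.[p.1] * g^`().[p.2] * arg (x - p.1) (y - p.2)
                          - f^`().[p.1] * g.[p.2] * lnr (x - p.1) (y - p.2)) =
  g.[1] * \int[mu]_(s in `[-1, 1]) (f.[s] * arg (x - s) (y - 1))
  - g.[-1] * \int[mu]_(s in `[-1, 1]) (f.[s] * arg (x - s) (y + 1))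
  - f.[1] * \int[mu]_(t in `[-1, 1]) (g.[t] * lnr (x - 1) (y - t))
  + f.[-1] * \int[mu]_(t in `[-1, 1]) (g.[t] * lnr (x + 1) (y - t))
  + 2 * pi * edge_value g y * (V.[Num.max 1 x] - V.[Num.max (-1) x]).
Proof.
move=> VE.
have mI : measurable (`[-1, 1] : set (measurableTypeR R)) by exact: measurable_itv.
have hS (t : R) : t \in `[-1, 1] ->
    \int[mu]_(s in `[-1, 1])
       (f^`().[s] * potIm (x - s) (y - t) - f.[s] * arg (x - s) (y - t)) =
    f.[1] * potIm (x - 1) (y - t) - f.[-1] * potIm (x - -1) (y - t).
  move=> tI; rewrite opprK.
  apply: (by_parts_reflect (fun u => potIm u (y - t)) (fun u => arg u (y - t))).
  - exact: continuous_potIm_x.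
  - by move=> u u0; exact: is_derive_potIm_x.
  - move=> u u0.
    exact: (is_derive_continuous _ _ _ (is_derive_arg_x u (y - t) u0)).
  - apply: (dominated_section2 phi psi iphi
      (fun s t => f^`().[s] * potIm (x - s) (y - t) - f.[s] * arg (x - s) (y - t))) => //.
    by apply: domB; apply: dom_poly1; [exact: dom_potIm|exact: dom_arg].
pose E s := cut_drop (x - s) * edge_value g y.
have hT (s : R) : s \in `[-1, 1] ->
    \int[mu]_(t in `[-1, 1])
       (g^`().[t] * potIm (x - s) (y - t) - g.[t] * lnr (x - s) (y - t)) =
    g.[1] * potIm (x - s) (y - 1) - g.[-1] * potIm (x - s) (y - -1) + E s.
  move=> sI; rewrite opprK.
  have i1 : mu.-integrable (`[-1, 1] : set R) (EFin \o (fun t : R =>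
      g^`().[t] * potIm (x - s) (y - t) - g.[t] * lnr (x - s) (y - t))).
    apply: (dominated_section1 phi psi ipsi
      (fun s t => g^`().[t] * potIm (x - s) (y - t) - g.[t] * lnr (x - s) (y - t))) => //.
    by apply: domB; apply: dom_poly2; [exact: dom_potIm|exact: dom_lnr].
  have i2 := integrable_poly_heaviside g^`() y.
  have i3 : mu.-integrable (`[-1, 1] : set R) (EFin \o (fun t : R =>
      cut_drop (x - s) * (g^`().[t] * heaviside y t))).
    by apply: eq_integrable (integrableZl mI (cut_drop (x - s)) i2).
  have aboveE (t : R) : g^`().[t] * potIm_above (x - s) (y - t) - g.[t] * lnr (x - s) (y - t) =
    (g^`().[t] * potIm (x - s) (y - t) - g.[t] * lnr (x - s) (y - t))
    + cut_drop (x - s) * (g^`().[t] * heaviside y t).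
    by rewrite potIm_aboveE subr_lt0 /heaviside; case: (y < t) => /=; ring.
  have i4 : mu.-integrable (`[-1, 1] : set R) (EFin \o (fun t : R =>
      g^`().[t] * potIm_above (x - s) (y - t) - g.[t] * lnr (x - s) (y - t))).
    by under [X in EFin \o X]eq_fun do rewrite aboveE; apply: eq_integrable (integrableD mI i1 i3).
  have da (u : R) (u0 : u != 0) := is_derive_potIm_above_y (x - s) u u0.
  have ca (u : R) : u != 0 -> {for u, continuous (fun u => lnr (x - s) u)}.
    by move=> u0; apply: continuous_lnr_y; rewrite u0 orbT.
  have := by_parts_reflect _ _ y g (continuous_potIm_above_y (x - s)) da ca i4.
  under eq_Rintegral do rewrite aboveE.
  rewrite RintegralD// RintegralZl// integral_heaviside !potIm_aboveE => h.
  apply: (addIr (cut_drop (x - s) * (g.[Num.max 1 y] - g.[Num.max (-1) y]))).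
  by rewrite h /E edge_valueE; ring.
have cdrop : continuous cut_drop.
  move=> u; rewrite (_ : cut_drop = (fun u => 2 * pi * Num.min u 0)); last first.
    by apply/funext => v; rewrite /cut_drop; case: ltP => //; rewrite mulr0.
  apply: (@cvgM _ _ (nbhs u)); first exact: cvg_cst.
  by apply: continuous_min; [exact: cvg_id|exact: cvg_cst].
have ddrop (u : R) : u != 0 -> is_derive u 1 cut_drop (if u < 0 then 2 * pi else 0).
  move=> u0; case: ifPn => un.
    have D := is_deriveZ (2 * pi) (is_derive_id u (1 : R)).
    apply: (@near_eq_is_derive _ _ _ (fun v => 2 * pi * v)).
      near=> v; rewrite /cut_drop.
      by have -> : v < 0 by near: v; exact: lt_nbhsl.
    by apply: (is_derive_eq D); rewrite /GRing.scale /= mulr1.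
  apply: (@near_eq_is_derive _ _ _ (cst 0)) (is_derive_cst 0 u 1).
  near=> v; rewrite /cut_drop.
  by have -> : (v < 0) = (u < 0) by [near: v; exact: near_sgn]; rewrite (negbTE un).
have idrop h : mu.-integrable (`[-1, 1] : set R) (EFin \o (fun s => h.[s] * cut_drop (x - s))).
  apply: continuous_compact_integrable; first exact: segment_compact.
  apply: continuous_subspaceT => s; apply: (@cvgM _ _ (nbhs s)); first exact: continuous_horner.
  by apply: continuous_reflect; exact: cdrop.
have iE : mu.-integrable (`[-1, 1] : set R) (EFin \o (fun s => f^`().[s] * E s)).
  apply: eq_integrable (integrableZl mI (edge_value g y) (idrop f^`())) => // s _ /=.
  by rewrite /E -EFinM; congr EFin; ring.
have := Green_square phi psi iphi ipsi (fun s t => potIm (x - s) (y - t))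
  (fun s t => arg (x - s) (y - t)) (fun s t => lnr (x - s) (y - t)) E f g
  dom_potIm dom_arg dom_lnr iE hS hT.
rewrite !opprK => ->; congr (_ + _).
have dropE : \int[mu]_(s in `[-1, 1]) (f^`().[s] * E s) =
    edge_value g y * \int[mu]_(s in `[-1, 1]) (f^`().[s] * cut_drop (x - s)).
  rewrite -RintegralZl//; apply: eq_Rintegral => s _; rewrite /E; ring.
have i2 := integrable_poly_heaviside f x.
have slopeE (s : R) : f^`().[s] * cut_drop (x - s) - f.[s] * (if x - s < 0 then 2 * pi else 0) =
    f^`().[s] * cut_drop (x - s) - 2 * pi * (f.[s] * heaviside x s).
  by rewrite subr_lt0 /heaviside; case: ifP => _; ring.
have i3 : mu.-integrable (`[-1, 1] : set R) (EFin \o (fun s => 2 * pi * (f.[s] * heaviside x s))).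
  by apply: eq_integrable (integrableZl mI (2 * pi) i2).
have cslope (u : R) : u != 0 ->
    {for u, continuous (fun u : R => if u < 0 then 2 * pi else 0 : R)}.
  move=> u0; have nu := near_sgn _ u0.
  have nh : \forall v \near u, (if u < 0 then 2 * pi else 0) = (if v < 0 then 2 * pi else 0) :> R.
    by near=> v; have -> : (v < 0) = (u < 0) by near: v.
  exact: (cvg_trans (near_eq_cvg nh) (cvg_cst (if u < 0 then 2 * pi else 0 : R))).
have islope : mu.-integrable (`[-1, 1] : set R) (EFin \o (fun s : R =>
    f^`().[s] * cut_drop (x - s) - f.[s] * (if x - s < 0 then 2 * pi else 0))).
  under [X in EFin \o X]eq_fun do rewrite slopeE.
  by apply: eq_integrable (integrableB mI (idrop _) i3).
have := by_parts_reflect _ _ x f cdrop ddrop cslope islope.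
under eq_Rintegral do rewrite slopeE.
rewrite RintegralB// RintegralZl// -{2}VE integral_heaviside dropE => /eqP.
rewrite subr_eq => /eqP ->.
by rewrite /E opprK; ring.
Unshelve. all: by end_near. Qed.

End LogGreen.

(** * Moments of the logarithm against polynomials *)

Section Assembly.
Context {R : realType}.
Notation mu := (@lebesgue_measure R).
Notation mu2 := (mu \x mu)%E.
Implicit Types (f g p q V : {poly R}) (x y : R) (k j : nat).
Notation P := (@legendre R).
Notation W := (@legendre_primitive R).
Notation V2 := (@legendre_primitive2 R).

Definition log_square x y p q : R[i] :=
  (\int[mu2]_(u in square) (p.[u.1] * q.[u.2] * lnr (x - u.1) (y - u.2))) +i*
  (\int[mu2]_(u in square) (p.[u.1] * q.[u.2] * arg (x - u.1) (y - u.2))).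

Definition log_hside x y p : R[i] :=
  (\int[mu]_(s in `[-1, 1]) (p.[s] * lnr (x - s) y)) +i*
  (\int[mu]_(s in `[-1, 1]) (p.[s] * arg (x - s) y)).

Definition log_vside x y p : R[i] :=
  (\int[mu]_(t in `[-1, 1]) (p.[t] * lnr x (y - t))) +i*
  (\int[mu]_(t in `[-1, 1]) (p.[t] * arg x (y - t))).

Lemma mul_clog x y (r : R) : clog (x +i* y) * r%:C = (r * lnr x y) +i* (r * arg x y).
Proof. by rewrite clogE; simpc; rewrite ![r * _]mulrC. Qed.

Lemma L2E x y k j : L2 (x +i* y) k j = log_square x y (P k) (P j).
Proof.
have h (s t : R) : x +i* y - (s +i* t) = (x - s) +i* (y - t) by simpc.
by rewrite /L2 /cintegral /log_square; congr (_ +i* _); apply: eq_Rintegral => u _;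
  rewrite h mul_clog.
Qed.

Lemma L1E x y k : L1 k (x +i* y) = log_hside x y (P k).
Proof.
have h (s : R) : x +i* y - s%:C = (x - s) +i* y by simpc.
by rewrite /L1 /cintegral /log_hside; congr (_ +i* _); apply: eq_Rintegral => s _;
  rewrite h mul_clog.
Qed.

Lemma M1E x y k : M1 k (x +i* y) = log_vside x y (P k).
Proof.
have h (t : R) : x +i* y - 'i%C * t%:C = x +i* (y - t) by simpc.
by rewrite /M1 /cintegral /log_vside; congr (_ +i* _); apply: eq_Rintegral => t _;
  rewrite h mul_clog.
Qed.

Lemma real_mulC (c a b : R) : c%:C * (a +i* b) = (c * a) +i* (c * b).
Proof. by simpc. Qed.

Lemma addC_parts (a b c d : R) : (a +i* b) + (c +i* d) = (a + c) +i* (b + d).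
Proof. by []. Qed.

Lemma subC_parts (a b c d : R) : (a +i* b) - (c +i* d) = (a - c) +i* (b - d).
Proof. by []. Qed.

Lemma mul_i (a b : R) : 'i%C * (a +i* b) = (- b) +i* a.
Proof. by simpc. Qed.

Lemma mul_2i (a : R) : 2 * 'i%C * a%:C = 0 +i* (2 * a).
Proof. by rewrite -mulrA mul_i mulr_natl mulr2n addC_parts; congr (_ +i* _); ring. Qed.

Lemma log_squareZl (c : R) x y p q :
  log_square x y (c *: p) q = c%:C * log_square x y p q.
Proof.
rewrite /log_square real_mulC -!RintegralZl//; try exact: measurable_square.
- by congr (_ +i* _); apply: eq_Rintegral => u _; rewrite hornerZ -!mulrA.
- exact: integrable_square_arg.
- exact: integrable_square_lnr.
Qed.

Lemma log_squareZr (c : R) x y p q :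
  log_square x y p (c *: q) = c%:C * log_square x y p q.
Proof.
rewrite /log_square real_mulC -!RintegralZl//; try exact: measurable_square.
- by congr (_ +i* _); apply: eq_Rintegral => u _; rewrite hornerZ; ring.
- exact: integrable_square_arg.
- exact: integrable_square_lnr.
Qed.

Lemma log_squareBl x y p1 p2 q :
  log_square x y (p1 - p2) q = log_square x y p1 q - log_square x y p2 q.
Proof.
rewrite /log_square; simpc; rewrite -!RintegralB; try exact: measurable_square;
  try exact: integrable_square_arg; try exact: integrable_square_lnr.
by congr (_ +i* _); apply: eq_Rintegral => u _; rewrite hornerD hornerN; ring.
Qed.

Lemma log_squareBr x y p q1 q2 :
  log_square x y p (q1 - q2) = log_square x y p q1 - log_square x y p q2.
Proof.
rewrite /log_square; simpc; rewrite -!RintegralB; try exact: measurable_square;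
  try exact: integrable_square_arg; try exact: integrable_square_lnr.
by congr (_ +i* _); apply: eq_Rintegral => u _; rewrite hornerD hornerN; ring.
Qed.

Lemma log_hsideZ (c : R) x y p : log_hside x y (c *: p) = c%:C * log_hside x y p.
Proof.
have [il ia] := integrable_hside x y p.
rewrite /log_hside real_mulC -!RintegralZl//.
by congr (_ +i* _); apply: eq_Rintegral => u _; rewrite hornerZ -!mulrA.
Qed.

Lemma log_vsideZ (c : R) x y p : log_vside x y (c *: p) = c%:C * log_vside x y p.
Proof.
have [il ia] := integrable_vside x y p.
rewrite /log_vside real_mulC -!RintegralZl//.
by congr (_ +i* _); apply: eq_Rintegral => u _; rewrite hornerZ -!mulrA.
Qed.

Lemma log_hsideB x y p1 p2 : log_hside x y (p1 - p2) = log_hside x y p1 - log_hside x y p2.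
Proof.
have [il1 ia1] := integrable_hside x y p1.
have [il2 ia2] := integrable_hside x y p2.
rewrite /log_hside; simpc; rewrite -!RintegralB//.
by congr (_ +i* _); apply: eq_Rintegral => u _; rewrite hornerD hornerN; ring.
Qed.

Lemma log_vsideB x y p1 p2 : log_vside x y (p1 - p2) = log_vside x y p1 - log_vside x y p2.
Proof.
have [il1 ia1] := integrable_vside x y p1.
have [il2 ia2] := integrable_vside x y p2.
rewrite /log_vside; simpc; rewrite -!RintegralB//.
by congr (_ +i* _); apply: eq_Rintegral => u _; rewrite hornerD hornerN; ring.
Qed.

(** For a linear functional [T], this converts the combinations of neighbouring indices
    produced by [C], and those in the definition of [F], into one primitive. *)
Lemma legendre_difference (T : {poly R} -> R[i]) k :
  (forall c p, T (c *: p) = c%:C * T p) ->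
  (forall p1 p2, T (p1 - p2) = T p1 - T p2) ->
  (T (P k.+1) - pred_entry (fun i => T (P i)) k) / (2 * k%:R + 1) = T (W k).
Proof.
move=> TZ TB; have k0 : 2 * k%:R + 1 != 0 :> R[i] by exact: odd_natr_neq0.
apply: (canLR (mulfK k0)); rewrite [RHS]mulrC.
have -> : pred_entry (fun i => T (P i)) k = T (if k is k'.+1 then P k' else 0).
  by case: k {k0} => [|k] //=; have := TZ 0 0; rewrite scale0r mul0r.
rewrite -TB legendre_primitive_diff TZ; congr (_ * _).
by rewrite rmorphD rmorphM /= !rmorph_nat.
Qed.

Lemma log_Green x y f g V : V^`() = f ->
  log_square x y f g^`() - 'i%C * log_square x y f^`() g =
  g.[1]%:C * log_hside x (y - 1) f - g.[-1]%:C * log_hside x (y + 1) f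
  - 'i%C * (f.[1]%:C * log_vside (x - 1) y g - f.[-1]%:C * log_vside (x + 1) y g)
  + 2 * 'i%C * (pi * edge_value g y * (V.[Num.max 1 x] - V.[Num.max (-1) x]))%:C.
Proof.
move=> VE; have hRe := Green_Re x y f g; have hIm := Green_Im x y f g V VE.
rewrite RintegralD in hRe; last 3 first.
- exact: measurable_square.
- exact: integrable_square_lnr.
- exact: integrable_square_arg.
rewrite RintegralB in hIm; last 3 first.
- exact: measurable_square.
- exact: integrable_square_arg.
- exact: integrable_square_lnr.
have {}hRe : complex.Re (log_square x y f g^`()) + complex.Im (log_square x y f^`() g) =
    g.[1] * complex.Re (log_hside x (y - 1) f) - g.[-1] * complex.Re (log_hside x (y + 1) f)
    + f.[1] * complex.Im (log_vside (x - 1) y g)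
    - f.[-1] * complex.Im (log_vside (x + 1) y g) := hRe.
have {}hIm : complex.Im (log_square x y f g^`()) - complex.Re (log_square x y f^`() g) =
    g.[1] * complex.Im (log_hside x (y - 1) f) - g.[-1] * complex.Im (log_hside x (y + 1) f)
    - f.[1] * complex.Re (log_vside (x - 1) y g)
    + f.[-1] * complex.Re (log_vside (x + 1) y g)
    + 2 * pi * edge_value g y * (V.[Num.max 1 x] - V.[Num.max (-1) x]) := hIm.
case: (log_square x y f _) (log_square x y _ g) hRe hIm => [a b] [c d].
case: (log_hside x (y - 1) f) (log_hside x (y + 1) f) => [p1 p2] [q1 q2].
case: (log_vside (x - 1) y g) (log_vside (x + 1) y g) => [u1 u2] [v1 v2] /= hRe hIm.
rewrite mul_2i !(real_mulC, mul_i, addC_parts, subC_parts).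
by congr (_ +i* _); [apply: (etrans (etrans _ hRe))|apply: (etrans (etrans _ hIm))]; ring.
Qed.

End Assembly.

(** * The cut contribution and the matrix equation *)

Section MatrixEquation.
Context {R : realType}.
Implicit Types (x y : R) (k j : nat) (z : R[i]).
Notation P := (@legendre R).
Notation W := (@legendre_primitive R).
Notation V2 := (@legendre_primitive2 R).

(** The terms [n_j] of [F] depend on whether [x - 1] and [x + 1] are negative, and [b]
    on the position of [x] with respect to [-1] and [1]: together they reproduce the
    increment of the primitive. The strip of [n_j] is taken here with its lower edge
    [y = - 1], where the missing part comes from [log_corners]. *)
Lemma jump_edge_value x y k j :
  edge_value (W j) y * ((V2 k).[Num.max 1 x] - (V2 k).[Num.max (-1) x]) =
  ultra_m12 j.+1 y * b_corr k (x +i* y)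
  + (if (k == 0%N) && (-1 <= y < 1) then
       ultra_m12 j.+1 y * ((if x < 1 then x - 1 else 0) + (if x < -1 then x + 1 else 0))
     else 0).
Proof.
have V1 := legendre_primitive2_1 (R := R) k.
have VN := legendre_primitive2_N1 (R := R) k.
have Wu : (W j).[y] = - ultra_m12 j.+1 y by rewrite ultra_m12E opprK.
rewrite /edge_value /b_corr /=; case: ifP => yI; last by rewrite mul0r mulr0 andbF add0r.
rewrite Wu andbT.
have [x1|x1] := ltP x 1.
  have [xN|xN] := ltP x (-1).
    rewrite V1 VN /=.
    by rewrite /b_left; case: k {V1 VN} => [|[|k]] /=; ring.
  rewrite V1 (ltW x1) /= b_squareE.
  by case: k {V1 VN} => [|k] /=; ring.
have xN1 : -1 <= x by lra.
rewrite (max_r xN1) subrr mulr0 [x < -1]ltNge xN1 /=.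
move: x1; rewrite le_eqVlt => /predU1P[<-|x1].
  by rewrite lexx b_square1; case: ifP => _; ring.
by rewrite leNgt x1 /=; case: ifP => _; ring.
Qed.

Lemma clog_cut (u v : R) : (u +i* v) * (clog (u +i* v) - clog_ (u +i* v)) =
  if (v == 0) && (u < 0) then 2 * 'i%C * (pi * u)%:C else 0.
Proof.
rewrite /clog_ /=; case: ifP => [/andP[/eqP -> un]|_]; last by rewrite subrr mulr0.
rewrite clogE /arg /carg /= lexx /Normc.normc expr0n addr0 sqrtr_sqr.
rewrite (_ : u / `|u| = -1); last by rewrite ltr0_norm// invrN mulrN divff// lt_eqF.
rewrite acosN1 /lnr expr0n addr0 sqrtr_sqr mul_2i subC_parts subrr opprK.
by simpc; congr (_ +i* _); ring.
Qed.

(** The four points [z + 1 + i, ..., z - 1 - i] occur in both pairs. The two corner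
    values at [z - 1 + i] and [z + 1 + i] use [log_-] in [m_0], which differs from [log]
    on the cut only. *)
Lemma log_corners x y :
  lambda 0 (x +i* y - 'i%C) + lambda 0 (x +i* y + 'i%C)
  - mu_m 0 (x +i* y - 1) - mu_m 0 (x +i* y + 1) =
  2 * 'i%C * (if y == -1 then
     pi * ((if x < 1 then x - 1 else 0) + (if x < -1 then x + 1 else 0)) else 0)%:C.
Proof.
have e1 : x +i* y - 'i%C - 1 = x +i* y - 1 - 'i%C by ring.
have e2 : x +i* y - 'i%C + 1 = x +i* y + 1 - 'i%C by ring.
have e3 : x +i* y + 'i%C - 1 = x +i* y - 1 + 'i%C by ring.
have e4 : x +i* y + 'i%C + 1 = x +i* y + 1 + 'i%C by ring.
rewrite /lambda /mu_m e1 e2 e3 e4.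
transitivity ((x +i* y - 1 + 'i%C) * (clog (x +i* y - 1 + 'i%C) - clog_ (x +i* y - 1 + 'i%C))
  + (x +i* y + 1 + 'i%C) * (clog (x +i* y + 1 + 'i%C) - clog_ (x +i* y + 1 + 'i%C))).
  by ring.
have -> : x +i* y - 1 + 'i%C = (x - 1) +i* (y + 1) by simpc.
have -> : x +i* y + 1 + 'i%C = (x + 1) +i* (y + 1) by simpc.
rewrite !clog_cut addr_eq0 subr_lt0 -[X in x + X < 0]opprK subr_lt0.
case: (y == -1); case: (x < 1); case: (x < -1);
  rewrite /= ?(addr0, add0r, mulr0, rmorph0)// -mulrDr -?rmorphD /= -?mulrDr//.
Qed.

Lemma mu_nE x y j (c : R) : mu_n j ((x + c) +i* y) =
  2 * 'i%C * (if -1 < y < 1 then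
     pi * (ultra_m12 j.+1 y * (if x + c < 0 then x + c else 0)) else 0)%:C.
Proof.
rewrite /mu_n /=; case: (_ < 0); case: (-1 < y < 1); rewrite /= ?mulr0 ?rmorph0 ?mulr0//.
by congr (_ * _%:C); ring.
Qed.

Lemma jump_term x y k j : let z := x +i* y in
  2 * 'i%C * (pi * edge_value (W j) y * ((V2 k).[Num.max 1 x] - (V2 k).[Num.max (-1) x]))%:C =
  beta_of b_corr k j z
  + (if k is 0 then mu_n j (z - 1) + mu_n j (z + 1)
      + (if j is 0 then lambda 0 (z - 'i%C) + lambda 0 (z + 'i%C)
           - mu_m 0 (z - 1) - mu_m 0 (z + 1) else 0)
     else 0).
Proof.
move=> z; rewrite -[pi * _ * _]mulrA jump_edge_value /beta_of.
have -> : complex.Im z = y by [].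
have corners := log_corners x y; rewrite -/z in corners.
have zm : z - 1 = (x - 1) +i* y by rewrite /z; simpc.
have zp : z + 1 = (x + 1) +i* y by rewrite /z; simpc.
case: k => [|k].
  have -> : (if j is 0 then lambda 0 (z - 'i%C) + lambda 0 (z + 'i%C)
       - mu_m 0 (z - 1) - mu_m 0 (z + 1) else 0) =
    2 * 'i%C * (if (j == 0%N) && (y == -1) then
     pi * ((if x < 1 then x - 1 else 0) + (if x < -1 then x + 1 else 0)) else 0)%:C.
    by case: j => [|j]; [exact: corners|rewrite rmorph0 mulr0].
  rewrite zm zp !mu_nE subr_lt0 -[X in x + X < 0]opprK subr_lt0 eqxx andTb.
  set A := if x < 1 then _ else _; set B := if x < -1 then _ else _.
  rewrite -!mulrDr -!rmorphD; congr (_ * _%:C).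
  rewrite /z; have [->|y1] := eqVneq y (-1).
    have -> : ultra_m12 j.+1 (-1 : R) = (j == 0%N)%:R.
      by rewrite ultra_m12E legendre_primitiveN1 opprK.
    rewrite ltxx lexx andTb (_ : (-1 : R) < 1); last by lra.
    case: (j == 0%N); rewrite /= ?(mul1r,mulr1,mul0r,mulr0,addr0,add0r).
      by rewrite mulrDr.
    by [].
  rewrite andbF [-1 <= y]le_eqVlt eq_sym (negbTE y1).
  by case: (_ && _) => /=; ring.
by rewrite (_ : (k.+1 == 0%N) = false)// andFb !addr0 mulrA.
Qed.

Lemma L1_edges x y k : let z := x +i* y in
  (L1 k.+1 (z - 'i%C) + L1 k.+1 (z + 'i%C)
     - pred_entry (L1^~ (z - 'i%C)) k - pred_entry (L1^~ (z + 'i%C)) k) / (2 * k%:R + 1) =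
  log_hside x (y - 1) (W k) + log_hside x (y + 1) (W k).
Proof.
move=> z; have -> : z - 'i%C = x +i* (y - 1) by rewrite /z; simpc.
have -> : z + 'i%C = x +i* (y + 1) by rewrite /z; simpc.
rewrite -!(legendre_difference (log_hside x _)); try by move=> *; rewrite (log_hsideZ, log_hsideB).
by case: k => [|k]; rewrite /= !L1E; ring.
Qed.

Lemma M1_edges x y j : let z := x +i* y in
  (M1 j.+1 (z - 1) + M1 j.+1 (z + 1)
     - pred_entry (M1^~ (z - 1)) j - pred_entry (M1^~ (z + 1)) j) / (2 * j%:R + 1) =
  log_vside (x - 1) y (W j) + log_vside (x + 1) y (W j).
Proof.
move=> z; have -> : z - 1 = (x - 1) +i* y by rewrite /z; simpc.
have -> : z + 1 = (x + 1) +i* y by rewrite /z; simpc.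
rewrite -!(legendre_difference (log_vside _ y)); try by move=> *; rewrite (log_vsideZ, log_vsideB).
by case: j => [|j]; rewrite /= !M1E; ring.
Qed.

Lemma matrix_equation z k j :
  infmx_mul (mxC R[i]) (L2 z) k j
     - 'i%C * infmx_mul (L2 z) (infmx_tr (mxC R[i])) k j = F_corr z k j.
Proof.
case: z => x y.
have -> : infmx_mul (mxC R[i]) (L2 (x +i* y)) k j = log_square x y (W k) (P j).
  rewrite /infmx_mul mxC_mul.
  rewrite -(legendre_difference (fun p => log_square x y p (P j)))//=.
  - by rewrite !L2E; case: k => [|k]; rewrite ?L2E.
  - by move=> c p; exact: log_squareZl.
  - by move=> p1 p2; exact: log_squareBl.
have -> : infmx_mul (L2 (x +i* y)) (infmx_tr (mxC R[i])) k j = log_square x y (P k) (W j).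
  rewrite /infmx_mul /infmx_tr.
  under eq_fsbigr do rewrite mulrC.
  rewrite mxC_mul -(legendre_difference (fun p => log_square x y (P k) p))//=.
  - by rewrite !L2E; case: j => [|j]; rewrite ?L2E.
  - by move=> c p; exact: log_squareZr.
  - by move=> p1 p2; exact: log_squareBr.
have G := log_Green x y (W k) (W j) (V2 k) (deriv_legendre_primitive2 k).
rewrite !deriv_legendre_primitive in G; rewrite G jump_term {G}.
have HL := L1_edges x y k; have HM := M1_edges x y j.
rewrite !legendre_primitive1 !legendre_primitiveN1.
rewrite /F_corr /F2_of /F1 /mu.
move: (x +i* y) HL HM => z.
move: (log_hside x (y - 1) (W k)) (log_hside x (y + 1) (W k)) => h1 h2.
move: (log_vside (x - 1) y (W j)) (log_vside (x + 1) y (W j)) => v1 v2 /= HL HM.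
case: k HL => [|k] HL.
  rewrite -[X in _ - (X + _ + _)]mulrA HM eqxx mulr1n rmorphN rmorph1.
  move: (mu_n j (z - 1)) (mu_n j (z + 1)) => n1 n2.
  case: j HM => [|[|j]] HM; rewrite ?HL; move: (beta_of _ _ _ _) => beta.
  - by rewrite eqxx mulr1n rmorphN rmorph1 /lambda /mu_m; ring.
  - by rewrite mulr0n oppr0 rmorph0 /mu_m; field.
  - by rewrite mulr0n oppr0 rmorph0 /mu_m; ring.
rewrite (_ : (k.+1 == 0%N) = false)// mulr0n oppr0 rmorph0.
case: j HM => [|j] HM; move: (beta_of _ _ _ _) => beta; last first.
  rewrite (_ : (j.+1 == 0%N) = false)// mulr0n oppr0 rmorph0.
  by case: k HL => [|k] HL; ring.
rewrite HL eqxx mulr1n rmorphN rmorph1.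
by case: k HL => [|k] HL; rewrite /lambda; [field|ring].
Qed.

End MatrixEquation.

Theorem theorem4p4 (R : realType) (z : R[i]) :
  (forall k j : nat, mxC R[i] k j =
     if j == k.+1 then 1 / (2 * k%:R + 1)
     else if k == j.+1 then - (1 / (2 * k%:R + 1))
     else 0) /\
  (~~ edge z -> forall k j : nat,
     infmx_mul (mxC R[i]) (L2 z) k j
     - 'i%C * infmx_mul (L2 z) (infmx_tr (mxC R[i])) k j = F z k j) /\
  (forall k j : nat,
     infmx_mul (mxC R[i]) (L2 z) k j
     - 'i%C * infmx_mul (L2 z) (infmx_tr (mxC R[i])) k j = F_corr z k j) /\
  infmx_rank_le 3 (F z) /\
  infmx_rank_le 3 (F_corr z).
Proof.
split; first exact: mxCE.
split; first by move=> ze k j; rewrite (F_corrE _ ze) matrix_equation.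
split; first exact: matrix_equation.
by split; exact: rank_F_of.
Qed.
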